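(* Let $n\in\mathbb{N}$. (i) Let $0<d\le n$ and $0\le\alpha<n$. Suppose that $d/n\le r<p<d/\alpha$ and $\frac{d-\alpha r}{q}=\frac{d-\alpha p}{p}$. Then $$\|M_{\alpha}f\|_{\mathrm{w}L^q(H^{d-\alpha r})}\lesssim\|f\|_{\mathrm{w}L^p(H^d)}.$$ (ii) Let $0<d<n$ and $0<\alpha<n$. Suppose that $d/n<r<p<d/\alpha$ and $\frac{d-\alpha r}{q}=\frac{d-\alpha p}{p}$. Then $$\|I_{\alpha}f\|_{\mathrm{w}L^q(H^{d-\alpha r})}\lesssim\|f\|_{\mathrm{w}L^p(H^d)}.$$ (iii) Let $0<d<n$ and $0<\alpha<n$. Suppose that $d/n<r<p<d/\alpha$ and $\frac{d-\alpha r}{q}=\frac{d-\alpha p}{p}$. Then $$\|I_{\alpha}f\|_{L^q(H^{d-\alpha r})}\lesssim\|f\|_{L^p(H^d)}.$$ In each part the inequality holds for all $f$ for which the right-hand side is finite, with an implicit constant independent of $f$.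
   Context: Functions are Lebesgue measurable functions on $\mathbb{R}^n$. $\mathcal{Q}(\mathbb{R}^n)$ is the family of all cubes in $\mathbb{R}^n$ with sides parallel to the coordinate axes; $\ell(Q)$ is the side length of $Q$. For $0<d\le n$, the $d$-dimensional Hausdorff content of $E\subset\mathbb{R}^n$ is $$H^d(E)=\inf\Big\{\sum_{j=1}^{\infty}\ell(Q_j)^d:\ E\subset\bigcup_{j=1}^{\infty}Q_j,\ Q_j\in\mathcal{Q}(\mathbb{R}^n)\Big\}.$$ For $f\ge0$ the Choquet integral is $\int_{\mathbb{R}^n}f\,dH^d=\int_0^\infty H^d(\{x\in\mathbb{R}^n: f(x)>t\})\,dt$. For $0<p<\infty$, $$\|f\|_{L^p(H^d)}=\Big(\int_{\mathbb{R}^n}|f|^p\,dH^d\Big)^{1/p},\qquad \|f\|_{\mathrm{w}L^p(H^d)}=\sup_{t>0}t\,H^d(\{x\in\mathbb{R}^n:|f(x)|>t\})^{1/p}.$$ The spaces $L^p(H^d)$ and $\mathrm{w}L^p(H^d)$ consist of the functions for which the respective quantity is finite. For $0\le\alpha<n$ the fractional maximal operator is $$M_\alpha f(x)=\sup_{Q\in\mathcal{Q}(\mathbb{R}^n)}\chi_Q(x)\,\ell(Q)^{\alpha-n}\int_Q|f(y)|\,dy,$$ where $\chi_Q$ is the characteristic function of $Q$. For $0<\alpha<n$ the fractional integral operator is $$I_\alpha f(x)=\int_{\mathbb{R}^n}\frac{f(y)}{|x-y|^{n-\alpha}}\,dy.$$ $d/\alpha$ is read as $\infty$ when $\alpha=0$.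 $A\lesssim B$ means $A\le CB$ with a constant $C>0$ that may depend on the parameters $n,d,\alpha,r,p,q$ but not on $f$. *)

(* Defs.v *)
From HB Require Import structures.
From mathcomp Require Import all_boot all_order all_algebra.
From mathcomp Require Import all_classical all_reals all_analysis.
From mathcomp Require Import measurable_realfun.

Set Implicit Arguments.
Unset Strict Implicit.
Unset Printing Implicit Defensive.

Import Order.TTheory GRing.Theory Num.Theory.
Import numFieldNormedType.Exports.

Local Open Scope classical_set_scope.
Local Open Scope ring_scope.

Section borel_lebesgue.
Context {R : realType}.
Local Notation T n := (n.-tuple (measurableTypeR R)).

Definition tuple_cons n (xy : measurableTypeR R * T n) : T n.+1 :=
  [tuple of xy.1 :: xy.2].

Lemma measurable_tuple_cons n : measurable_fun setT (@tuple_cons n).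
Proof.
by apply: (@measurable_cons _ _ _ _ fst n snd);
  [exact: measurable_fst|exact: measurable_snd].
Qed.

HB.instance Definition _ n :=
  isMeasurableFun.Build _ _ _ _ (@tuple_cons n) (@measurable_tuple_cons n).

Section succ.
Variables (n : nat) (m : {sigma_finite_measure set (T n) -> \bar R}).

Definition succ_measure : set (T n.+1) -> \bar R :=
  pushforward (lebesgue_measure \x m)%E (@tuple_cons n).

Let succ_measure0 : succ_measure set0 = 0%E.
Proof. exact: measure0. Qed.

Let succ_measure_ge0 A : (0 <= succ_measure A)%E.
Proof. exact: measure_ge0. Qed.

Let succ_measure_sigma_additive : semi_sigma_additive succ_measure.
Proof. exact: measure_semi_sigma_additive. Qed.

HB.instance Definition _ := isMeasure.Build _ _ _ succ_measure
  succ_measure0 succ_measure_ge0 succ_measure_sigma_additive.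

Lemma measurable_tail (A : set (T n)) : measurable A ->
  measurable [set x : T n.+1 | A [tuple of behead x]].
Proof.
by move=> mA; rewrite -[X in measurable X]setTI; exact: measurable_behead.
Qed.

Lemma measurable_head k (A : set (measurableTypeR R)) : measurable A ->
  measurable [set x : T k.+1 | A (thead x)].
Proof.
by move=> mA; rewrite -[X in measurable X]setTI; exact: measurable_tnth.
Qed.

Lemma succ_measureE (A : set (measurableTypeR R)) (B : set (T n)) :
  measurable A -> measurable B ->
  succ_measure [set x | A (thead x) /\ B [tuple of behead x]] =
  (lebesgue_measure A * m B)%E.
Proof.
move=> mA mB; rewrite -product_measure1E// /succ_measure /pushforward.
congr (product_measure1 _ _ _).
have yE x (y : T n) : [tuple of behead (tuple_cons (x, y))] = y.
  exact: val_inj.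
by apply/seteqP; split=> -[x y] /=; rewrite yE theadE.
Qed.

Let succ_measure_sigma_finite : sigma_finite setT succ_measure.
Proof.
have /sigma_finiteP[F [TF ndF Foo]] := sigma_finiteT (@lebesgue_measure R).
have /sigma_finiteP[G [TG ndG Goo]] := sigma_finiteT m.
exists (fun k => [set x | F k (thead x) /\ G k [tuple of behead x]]).
  apply/esym/seteqP; split=> // x _.
  have [i _ Fi] : (\bigcup_i F i) (thead x) by rewrite -TF.
  have [j _ Gj] : (\bigcup_i G i) [tuple of behead x] by rewrite -TG.
  exists (maxn i j) => //; split.
  - by move: Fi; exact/subsetPset/ndF/leq_maxl.
  - by move: Gj; exact/subsetPset/ndG/leq_maxr.
move=> k; have [? ?] := Foo k; have [? ?] := Goo k; split.
  by apply: measurableI; [exact: measurable_head|exact: measurable_tail].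
by rewrite succ_measureE// lte_mul_pinfty// ge0_fin_numE.
Qed.

HB.instance Definition _ := Measure_isSigmaFinite.Build _ _ _ succ_measure
  succ_measure_sigma_finite.

End succ.

(* The [n]-fold product of the Lebesgue measure of [R], on Borel sets. *)
Fixpoint borel_lebesgue n : {sigma_finite_measure set (T n) -> \bar R} :=
  if n is k.+1 return {sigma_finite_measure set (T n) -> \bar R}
  then succ_measure (borel_lebesgue k) else \d_([tuple]).

Lemma borel_lebesgue_box n (A : 'I_n -> set (measurableTypeR R)) :
  (forall i, measurable (A i)) ->
  measurable [set x : T n | forall i, A i (tnth x i)] /\
  borel_lebesgue n [set x : T n | forall i, A i (tnth x i)] =
    (\prod_(i < n) lebesgue_measure (A i))%E.
Proof.
elim: n A => [|n ih] A mA.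
  have -> : [set x : T 0 | forall i, A i (tnth x i)] = setT.
    by apply/seteqP; split=> // x _ [].
  by split=> //; rewrite big_ord0 /= diracE in_setT.
have [mB BE] := ih (fun i => A (lift ord0 i)) (fun i => mA (lift ord0 i)).
set B := [set x | _] in mB BE.
have -> : [set x : T n.+1 | forall i, A i (tnth x i)] =
    [set x | A ord0 (thead x) /\ B [tuple of behead x]].
  apply/seteqP; split=> [x Ax|x [Ax Bx] i] /=.
    split; first exact: Ax.
    move=> i; move: (Ax (lift ord0 i)).
    by rewrite (tuple_eta x) tnthS -tuple_eta.
  have [j ->|->//] := unliftP ord0 i.
  by move: (Bx j) => /=; rewrite [in X in _ -> X](tuple_eta x) tnthS.
split.
  by apply: measurableI; [exact: measurable_head|exact: measurable_tail].
by rewrite /= succ_measureE// BE big_ord_recl.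
Qed.

End borel_lebesgue.

(* [R^n] with the sigma-algebra of Lebesgue measurable sets, obtained as the sets
   that are Carathéodory measurable for the outer measure of [borel_lebesgue];
   its points are tuples. *)
Definition euclidean (R : realType) (n : nat) :=
  caratheodory_type ((@borel_lebesgue R n)^*)%mu.

HB.instance Definition _ R n := Measurable.on (euclidean R n).

Definition lebesgue (R : realType) (n : nat) : set (euclidean R n) -> \bar R :=
  @completed_measure_extension _ _ _ (@borel_lebesgue R n).

HB.instance Definition _ R n := Measure.on (@lebesgue R n).

Section operators.
Context {R : realType} {n : nat}.
Local Notation Rn := (euclidean R n).
Local Notation mu := (@lebesgue R n).
Implicit Types (x y : Rn) (E : set Rn) (f : Rn -> \bar R) (d p : R).

Definition coordinate x (i : 'I_n) : R := tnth (x : n.-tuple R) i.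

Record cube := Cube { corner : Rn; side : R; side_gt0 : 0 < side }.

(* Closed cubes; open or half-open ones yield the same [hcontent] and the same
   [fmaximal]. *)
Definition cube_set (Q : cube) : set Rn :=
  [set x | forall i, coordinate (corner Q) i <= coordinate x i
                     <= coordinate (corner Q) i + side Q].
Coercion cube_set : cube >-> set.

Lemma lebesgue_cube (Q : cube) :
  measurable (cube_set Q) /\ mu (cube_set Q) = ((side Q) ^+ n)%:E.
Proof.
pose A i : set (measurableTypeR R) :=
  [set` `[coordinate (corner Q) i, coordinate (corner Q) i + side Q]].
have [|mA AE] := @borel_lebesgue_box R n A.
  by move=> i; exact: measurable_itv.
have -> : cube_set Q = [set x | forall i, A i (tnth x i)].
  by apply/seteqP; split=> x Qx i; move: (Qx i); rewrite /A /= in_itv.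
split.
  by apply: sub_caratheodory; exact: sub_sigma_algebra.
transitivity (borel_lebesgue n
    [set x : n.-tuple (measurableTypeR R) | forall i, A i (tnth x i)]).
  exact: measurable_mu_extE.
rewrite AE.
under eq_bigr do
  rewrite lebesgue_measure_itv/= lte_fin ltrDl side_gt0 -EFinB addrAC subrr add0r.
by rewrite prodEFin prodr_const card_ord.
Qed.

Definition hcontent d E : \bar R :=
  ereal_inf [set (\sum_(0 <= j <oo) (side (Q j) `^ d)%:E)%E |
             Q in [set Q : nat -> cube | E `<=` \bigcup_j Q j]].

Definition choquet d f : \bar R :=
  (\int[lebesgue_measure]_(t in `]0%R, +oo[) hcontent d [set x | t%:E < f x])%E.

Definition Lnorm_hcontent d p f : \bar R :=
  (choquet d (fun x => `|f x| `^ p) `^ p^-1)%E.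

Definition wLnorm_hcontent d p f : \bar R :=
  ereal_sup [set (t%:E * hcontent d [set x | t%:E < `|f x|] `^ p^-1)%E |
             t in `]0, +oo[].

Definition fmaximal (alpha : R) f x : \bar R :=
  ereal_sup [set ((\1_(Q : set Rn) x)%:E * (side Q `^ (alpha - n%:R))%:E *
                  \int[mu]_(y in Q) `|f y|)%E | Q in [set: cube]].

Definition euclidean_dist x y : R :=
  Num.sqrt (\sum_(i < n) (coordinate x i - coordinate y i) ^+ 2).

(* The kernel takes the value [0] on the diagonal, which is immaterial to the
   integral when [0 < n].  If the positive and the negative parts of the
   integrand both have infinite integral, then the value is [+oo - +oo = -oo],
   whose absolute value is infinite. *)
Definition fintegral (alpha : R) f x : \bar R :=
  (\int[mu]_y (f y * ((euclidean_dist x y `^ (n%:R - alpha))^-1)%:E))%E.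

End operators.

(* [d / alpha], read as [+oo] when [alpha = 0]. *)
Definition critical_exponent (R : realType) (d alpha : R) : \bar R :=
  if alpha == 0 then +oo%E else (d / alpha)%:E.

(* Main.v *)
Require Import Defs.
From mathcomp Require Import all_boot all_order all_algebra.
From mathcomp Require Import all_classical all_reals all_analysis.
From mathcomp Require Import measurable_realfun.
From mathcomp Require Import zify ring lra.

Set Implicit Arguments.
Unset Strict Implicit.
Unset Printing Implicit Defensive.

Import Order.TTheory GRing.Theory Num.Theory.
Local Open Scope classical_set_scope.
Local Open Scope ring_scope.

(** Rescale [f] by an upper bound of its norm: [g = |f| / A] satisfies
    [H^d (g > t) <= t ^ (- p)] for all [t > 0] in the weak as in the strong case.
    Fix a height [lam] and split [g] into its levels [g > lam * 2 ^ k], [k] an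
    integer.

    The volume of a set is at most the power [n / d] of its content
    ([lebesgue_le_hcontent]). Suppose that a dyadic cube [P] of side [l] has a
    fractional average [l ^ (alpha - n) * \int_P g] larger than a multiple of
    [lam ^ (1 - p alpha / d)]. The levels below [lam] are too small to produce it,
    by the normalisation of [g]. Hence some level [k >= 0] is responsible, and
    bounding its volume in [P] by [l ^ (n - d / r)] times the power [1 / r] of its
    content in [P] gives, with [e = p (d - alpha r) / d],
    [lam ^ e * l ^ (d - alpha r) <= (lam 2 ^ k) ^ p * 2 ^ (- k kappa) *
    H^d (P, g > lam 2 ^ k)] for some [kappa > 0] ([light_level]).

    Such cubes have to be summed, although the content is not additive on disjoint
    cubes. The remedy is Melnikov's packing lemma: a greedy selection keeps the cubes
    as long as the weights [l ^ (d - alpha r)] of the kept cubes inside of each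
    dyadic cube [Q] do not exceed twice the weight of [Q]. The rejected cubes lie in cubes that are already full, so that the content
    of the union is bounded by the weights of the kept cubes ([hcontent_packing]);
    along a packed family, on the other hand, the content [H^d] is additive up to a
    constant ([hcontent_packed]). Together they bound the content of the set where
    the fractional maximal function exceeds its threshold by
    [lam ^ (- e) * \sum_(k >= 0) (lam 2 ^ k) ^ p * 2 ^ (- k kappa) *
    H^d (g > lam 2 ^ k)] ([hcontent_bigavg]).

    The fractional integral obeys the same estimate. Choose [beta < alpha] close to
    [alpha] and [rho] with [beta rho = alpha r], so that the target dimension does
    not change. At a point where the maximal function of order [beta] is below its
    threshold, the part of the integral over small distances is controlled by this
    maximal function and the part over large distances by the normalisation, and
    the distance at which both agree gives exactly the threshold of order [alpha]
    ([riesz_pointwise]); this is Hedberg's argument.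

    The weak type inequalities follow by bounding each term of the sum by the
    normalisation. For the strong one, both Choquet integrals are discretised along
    geometric progressions and the estimates for [lam = 2 ^ j] are summed over all
    integers [j] ([sum_level_sum]). *)

(** * Sums over countable types *)

Section countable_sums.
Context {R : realType} {I : countType}.
Implicit Types a b : I -> \bar R.
Local Open Scope ereal_scope.

(** The sum is taken along the enumeration of [I] by [pickle]; its gaps contribute
    [0]. *)
Lemma esum_series a : (forall i, 0 <= a i) ->
  \esum_(i in [set: I]) a i = \sum_(k <oo) oapp a 0 (pickle_inv k).
Proof.
move=> a0; set b := fun k => oapp a 0 (pickle_inv k).
have b0 k : 0 <= b k by rewrite /b; case: (pickle_inv k) => //=.
rewrite nneseries_esumT//.
transitivity (\esum_(k in range (@pickle I)) b k).
  rewrite esum_image; last by move=> i j _ _; exact: (pcan_inj pickleK).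
  by apply: eq_esum => i _; rewrite /b pickleK_inv.
rewrite esum_mkcond; apply: eq_esum => k _; case: ifPn => // /negP kI.
rewrite /b; case Ek: (pickle_inv k) => [i|//]; case: kI; apply/mem_set.
by exists i => //; have := @pickle_invK I k; rewrite Ek.
Qed.

Lemma esumZl (c : R) a : (0 <= c)%R -> (forall i, 0 <= a i) ->
  \esum_(i in [set: I]) (c%:E * a i) = c%:E * \esum_(i in [set: I]) a i.
Proof.
move=> c0 a0; rewrite !esum_series//; last by move=> i; rewrite mule_ge0.
rewrite -nneseriesZl; last by move=> k _; case: (pickle_inv k) => //=.
by apply: eq_eseriesr => k _; case: (pickle_inv k) => //=; rewrite mule0.
Qed.

Lemma esum_sub (J : choiceType) (A : set J) (f : J -> I) (a : J -> \bar R) b :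
  set_inj A f -> (forall i, 0 <= b i) -> (forall j, A j -> a j <= b (f j)) ->
  \esum_(j in A) a j <= \esum_(i in [set: I]) b i.
Proof.
move=> finj b0 ab; apply: (@le_trans _ _ (\esum_(i in f @` A) b i)).
  by rewrite esum_image//; exact: le_esum.
rewrite esum_mkcond; apply: le_esum => i _.
by case: ifPn.
Qed.

Lemma esum_term a i : (forall i, 0 <= a i) -> a i <= \esum_(i in [set: I]) a i.
Proof.
move=> a0; rewrite -(@esum_set1 _ _ i)// esum_mkcond.
by apply: le_esum => j _; case: ifPn.
Qed.

Context d {T : measurableType d} (mu : {measure set T -> \bar R}).

Lemma measurable_esum (D : set T) (F : I -> T -> \bar R) :
  (forall i x, 0 <= F i x) -> (forall i, measurable_fun D (F i)) ->
  measurable_fun D (fun x => \esum_(i in [set: I]) F i x).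
Proof.
move=> F0 mF; rewrite (_ : (fun x => _) = fun x =>
  \sum_(k <oo | k \in xpredT) oapp (F^~ x) 0 (pickle_inv k)); last first.
  by apply/funext => x; rewrite esum_series//; apply: eq_eseriesl.
apply: ge0_emeasurable_sum => k; first by case: (pickle_inv k) => //=.
by move=> _; case: (pickle_inv k) => //=.
Qed.

Lemma integral_esum (D : set T) (F : I -> T -> \bar R) : measurable D ->
  (forall i x, 0 <= F i x) -> (forall i, measurable_fun D (F i)) ->
  \int[mu]_(x in D) (\esum_(i in [set: I]) F i x) =
  \esum_(i in [set: I]) \int[mu]_(x in D) F i x.
Proof.
move=> mD F0 mF; rewrite esum_series; last first.
  by move=> i; apply: integral_ge0.
under eq_integral do rewrite esum_series//.
rewrite integral_nneseries//.
- by apply: eq_eseriesr => k _; case: (pickle_inv k) => [i|] //=; rewrite integral0.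
- by move=> k; case: (pickle_inv k) => //=.
- by move=> k x _; case: (pickle_inv k) => //=.
Qed.

(** Upper bounds of integrals by sums are obtained from pointwise countable
    majorants, which need not come from a partition of the domain. *)
Lemma le_integral_esum (D : set T) (g : T -> \bar R) (F : I -> T -> \bar R) :
  measurable D -> (forall x, 0 <= g x) -> measurable_fun D g ->
  (forall i x, 0 <= F i x) -> (forall i, measurable_fun D (F i)) ->
  (forall x, D x -> g x <= \esum_(i in [set: I]) F i x) ->
  \int[mu]_(x in D) g x <= \esum_(i in [set: I]) \int[mu]_(x in D) F i x.
Proof.
move=> mD g0 mg F0 mF gF; rewrite -integral_esum//.
by apply: ge0_le_integral => //; exact: measurable_esum.
Qed.

End countable_sums.

Section finite_sums.
Context {R : realType}.
Local Open Scope ereal_scope.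

Lemma esum_fin (I : finType) (a : I -> \bar R) : (forall i, 0 <= a i) ->
  \esum_(i in [set: I]) a i = \sum_i a i.
Proof.
move=> a0.
rewrite esum_fset//; last exact: finite_finset.
rewrite (@fsbigE _ _ _ _ _ (enum I)) ?enum_uniq//; last first.
  by move=> i _; rewrite mem_enum.
by rewrite big_enum_cond/=; apply: eq_bigl => i; rewrite in_setT.
Qed.

Lemma esum_le (I : countType) (a : I -> \bar R) (b : \bar R) :
  (forall S : seq I, uniq S -> \sum_(i <- S) a i <= b) ->
  \esum_(i in [set: I]) a i <= b.
Proof.
move=> Sb; apply: ge_ereal_sup => _ [X [finX _]] <-.
rewrite fsbig_finite//=; apply: Sb; exact: finmap.fset_uniq.
Qed.

End finite_sums.

(** * Two-sided geometric series *)

Section twosided.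
Context {R : realType}.

Definition twosided (eta : R) : R :=
  fine (\esum_(k in [set: int]) (2 `^ (- (`|k|%:R * eta)))%:E)%E.

Let geom (eta : R) : 0 < eta ->
  (\sum_(k <oo) (2 `^ (- (k%:R * eta)))%:E <= ((1 - 2 `^ (- eta))^-1)%:E)%E.
Proof.
move=> eta0; apply: lime_le.
  by apply: is_cvg_nneseries => k _; rewrite lee_fin powR_ge0.
have x0 : 0 < (2 : R) `^ (- eta) by rewrite powR_gt0.
have x1 : `|(2 : R) `^ (- eta)| < 1.
  rewrite gtr0_norm// powRN invf_lt1 ?powR_gt0//.
  by rewrite -[ltLHS](powRr0 2) /powR ?gt_eqF// ltr_expR ltr_pM2r// ln_gt0// ltr1n.
apply: nearW => m; rewrite sumEFin lee_fin.
have := geometric_le_lim m ler01 x0 x1; rewrite mul1r; apply: le_trans.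
rewrite /series/= le_eqVlt; apply/orP; left; apply/eqP; apply: eq_bigr => k _.
by rewrite mul1r -powR_mulrn ?powR_ge0// -powRrM -mulrN mulrC.
Qed.

Lemma twosidedE (eta : R) : 0 < eta ->
  (\esum_(k in [set: int]) (2 `^ (- (`|k|%:R * eta)))%:E)%E = (twosided eta)%:E.
Proof.
move=> eta0; rewrite /twosided fineK// ge0_fin_numE; last first.
  by apply: esum_ge0 => k _; rewrite lee_fin powR_ge0.
set F := fun k : int => (2 `^ (- (`|k|%:R * eta)))%:E.
have F0 k : (0 <= F k)%E by rewrite lee_fin powR_ge0.
rewrite (esumID (range Posz))//.
rewrite !setTI.
have -> : ~` range Posz = range Negz.
  apply/seteqP; split => [[n|n]|_ [n _ <-]].
  - by move=> /(_ _)/= []; exists n.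
  - by exists n.
  - by move=> [m _].
rewrite !esum_image; last 2 first.
- by move=> i j _ _ [].
- by move=> i j _ _ [].
rewrite -!nneseries_esumT//.
apply: lte_add_pinfty.
  by apply: le_lt_trans (geom eta0) _; exact: ltry.
apply: le_lt_trans (ltry ((1 - 2 `^ (- eta))^-1)).
apply: le_trans (geom eta0); apply: lee_nneseries => // k _.
rewrite /F/= lee_fin ler_powR ?ler1n// lerN2 ler_wpM2r ?ler_nat//.
exact: ltW.
Qed.

Lemma twosided_gt0 (eta : R) : 0 < eta -> 0 < twosided eta.
Proof.
move=> eta0; rewrite -lte_fin -twosidedE//.
apply: (@lt_le_trans _ _ (2 `^ (- (`|0 : int|%:R * eta)))%:E).
  by rewrite absz0 mul0r oppr0 powRr0 lte_fin.
apply: (esum_term (a := fun k : int => (2 `^ (- (`|k|%:R * eta)))%:E)) => k.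
by rewrite lee_fin powR_ge0.
Qed.

End twosided.

(** * Hausdorff content *)

Section content.
Context {R : realType} {n : nat}.
Local Notation Rn := (euclidean R n).
Local Notation mu := (@lebesgue R n).
Implicit Types (x y : Rn) (E : set Rn) (d : R).

Lemma hcontent_ge0 d E : (0 <= hcontent d E)%E.
Proof.
apply: le_ereal_inf_tmp => _ [Q _ <-]; apply: nneseries_ge0 => j _ _.
by rewrite lee_fin powR_ge0.
Qed.

Lemma le_hcontent d E F : E `<=` F -> (hcontent d E <= hcontent d F)%E.
Proof.
move=> EF; apply: le_ereal_inf_tmp => _ [Q FQ <-]; apply: ereal_inf_lbound.
by exists Q => //; exact: subset_trans FQ.
Qed.

(** The side [0] stands for an empty member of the cover. In a sequence of genuine
    cubes, the empty members and the gaps of the enumeration of [I] are replaced by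
    cubes so small that their total weight is at most [e]. *)
Lemma hcontent_cover (I : countType) (c : I -> Rn) (s : I -> R) d E :
  0 < d -> (forall i, 0 <= s i) ->
  (forall x, E x -> exists2 i, 0 < s i & forall j,
     coordinate (c i) j <= coordinate x j <= coordinate (c i) j + s i) ->
  (hcontent d E <= \esum_(i in [set: I]) (s i `^ d)%:E)%E.
Proof.
move=> d0 s0 Ecov; apply/lee_addgt0Pr => e e0.
pose w k := (e / (2 ^ k.+1)%:R) `^ d^-1.
have w0 k : 0 < w k by rewrite powR_gt0// divr_gt0// ltr0n expn_gt0.
pose v k := oapp s 0 (pickle_inv k).
have v0 k : 0 <= v k by rewrite /v; case: (pickle_inv k) => //=.
have vw0 k : 0 < Num.max (v k) (w k) by rewrite lt_max w0 orbT.
pose Q k := Cube (oapp c (point : Rn) (pickle_inv k)) (vw0 k).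
apply: (@le_trans _ _ (\sum_(0 <= j <oo) (side (Q j) `^ d)%:E)%E).
  apply: ereal_inf_lbound; exists Q => // x /Ecov[i si xi].
  exists (pickle i) => // j; rewrite /= /v pickleK_inv/=.
  have /andP[-> /=] := xi j; move=> /le_trans -> //.
  by rewrite lerD2l le_max lexx.
rewrite esum_series; last by move=> i; rewrite lee_fin powR_ge0.
apply: le_trans (epsilon_trick _ _ (ltW e0)); last first.
  by move=> k; case: (pickle_inv k) => //= i; rewrite lee_fin powR_ge0.
apply: lee_nneseries => [k _ _|k _]; first by rewrite lee_fin powR_ge0.
have wE : w k `^ d = e / (2 ^ k.+1)%:R.
  rewrite /w -powRrM mulVf ?gt_eqF// powRr1// divr_ge0 ?ler0n//; exact: ltW.
have -> : (oapp (fun i => (s i `^ d)%:E) 0 (pickle_inv k) = (v k `^ d)%:E)%E.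
  by rewrite /v; case: (pickle_inv k) => //=; rewrite powR0// gt_eqF.
rewrite -wE -EFinD lee_fin /=.
by rewrite /Num.max; case: ifPn => _; rewrite ?lerDl ?lerDr powR_ge0.
Qed.

(** Since [d <= n], the map [s |-> s `^ (n / d)] is superadditive, so the
    volumes [(l ^ d) ^ (n / d)] of the cubes of a cover sum up to at most the
    power [n / d] of the sum of the [l ^ d]. *)
Lemma lebesgue_le_hcontent d E : 0 < d -> d <= n%:R -> measurable E ->
  (mu E `^ (d / n%:R) <= hcontent d E)%E.
Proof.
move=> d0 dn mE; have n0 : 0 < n%:R :> R by exact: lt_le_trans dn.
apply: le_ereal_inf_tmp => _ [Q EQ <-].
set S := (\sum_(0 <= j <oo) _)%E.
have S0 : (0 <= S)%E.
  by apply: nneseries_ge0 => j _ _; rewrite lee_fin powR_ge0.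
have Qj j : ((side (Q j) `^ d)%:E <= S)%E.
  rewrite /S nneseries_esumT; last by move=> i; rewrite lee_fin powR_ge0.
  apply: (esum_term (a := fun i => (side (Q i) `^ d)%:E)).
  by move=> i; rewrite lee_fin powR_ge0.
move: S0 Qj; case ES : S => [s| |] //; last by move=> *; rewrite leey.
rewrite lee_fin => s0 Qj.
have nd1 : 0 <= n%:R / d - 1 by rewrite subr_ge0 ler_pdivlMr// mul1r.
have muE : (mu E <= (s `^ (n%:R / d))%:E)%E.
  apply: (@le_trans _ _ (\sum_(0 <= j <oo) mu (Q j))%E).
    apply: measure_sigma_subadditive => // j.
    by have [] := lebesgue_cube (Q j).
  apply: (@le_trans _ _
    (\sum_(0 <= j <oo) ((s `^ (n%:R / d - 1))%:E * (side (Q j) `^ d)%:E))%E).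
    apply: lee_nneseries => j *; first exact: measure_ge0.
    rewrite (lebesgue_cube (Q j)).2 -EFinM lee_fin.
    have l0 := side_gt0 (Q j).
    rewrite -powR_mulrn ?(ltW l0)//.
    have -> : side (Q j) `^ n%:R =
        (side (Q j) `^ d) `^ (n%:R / d - 1) * side (Q j) `^ d.
      rewrite -powRrM -powRD; last by rewrite (gt_eqF l0) implybT.
      by congr (_ `^ _); field; rewrite gt_eqF.
    rewrite ler_wpM2r ?powR_ge0//.
    apply: ge0_ler_powR => //; rewrite ?nnegrE ?powR_ge0//.
    by have := Qj j; rewrite lee_fin.
  rewrite nneseriesZl; last by move=> j _; rewrite lee_fin powR_ge0.
  rewrite -/S ES -EFinM lee_fin -[X in _ * X]powRr1// -powRD ?subrK//.
  by rewrite gt_eqF// divr_gt0.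
have -> : s%:E = ((s `^ (n%:R / d))%:E `^ (d / n%:R))%E.
  rewrite poweR_EFin -powRrM.
  have -> : n%:R / d * (d / n%:R) = 1 :> R by field; rewrite !gt_eqF.
  by rewrite powRr1.
apply: gt0_ler_poweR => //; first by rewrite divr_ge0 ?ler0n// ltW.
- by rewrite in_itv/= measure_ge0 leey.
- by rewrite in_itv/= lee_fin powR_ge0 leey.
Qed.

(** Interpolation with weight [th] between the bound of a volume by the volume
    of a cube of side [l] and its bound by the content [v]. *)
Lemma lebesgue_interp d E (l v th : R) : 0 < d -> d <= n%:R -> measurable E ->
  0 <= th <= 1 -> 0 <= l ->
  (mu E <= (l `^ n%:R)%:E)%E -> (hcontent d E <= v%:E)%E ->
  (mu E <= (l `^ (n%:R * (1 - th)) * v `^ (n%:R / d * th))%:E)%E.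
Proof.
move=> d0 dn mE /andP[th0 th1] l0 El Ev.
have n0 : 0 < n%:R :> R by exact: lt_le_trans dn.
have := le_trans (lebesgue_le_hcontent d0 dn mE) Ev.
have : (0 <= mu E)%E by exact: measure_ge0.
move: El; case: (mu E) => [m| |] //.
rewrite !lee_fin => ml; rewrite le_eqVlt => /predU1P[<- _|m0 mv].
  by rewrite mulr_ge0 ?powR_ge0.
have v0 : 0 <= v by apply: le_trans mv; rewrite powR_ge0.
have -> : m = m `^ (1 - th) * m `^ th.
  by rewrite -powRD ?subrK ?powRr1 ?(ltW m0)// (gt_eqF m0) implybT.
rewrite ler_pM ?powR_ge0//.
  rewrite powRrM; apply: ge0_ler_powR; rewrite ?nnegrE ?powR_ge0// ?subr_ge0//.
  exact: ltW.
have -> : m `^ th = (m `^ (d / n%:R)) `^ (n%:R / d * th).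
  by rewrite -powRrM; congr (_ `^ _); field; rewrite !gt_eqF.
apply: ge0_ler_powR; rewrite ?nnegrE ?powR_ge0// mulr_ge0// divr_ge0 ?ler0n//.
exact: ltW.
Qed.

End content.

(** * Dyadic cubes *)

Section dyadic_scale.
Context {R : realType}.

Lemma pow2_gt0 (x : R) : 0 < 2 `^ x. Proof. by rewrite powR_gt0. Qed.

Lemma ltr_pow2 (x y : R) : ((2 : R) `^ x < 2 `^ y) = (x < y).
Proof. by rewrite /powR gt_eqF// ltr_expR ltr_pM2r// ln_gt0// ltr1n. Qed.

Lemma ler_pow2 (x y : R) : ((2 : R) `^ x <= 2 `^ y) = (x <= y).
Proof. by rewrite leNgt ltr_pow2 -leNgt. Qed.

Lemma pow2D (x y : R) : (2 : R) `^ (x + y) = 2 `^ x * 2 `^ y.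
Proof. by rewrite powRD// pnatr_eq0 implybT. Qed.

Lemma pow2_log (s : R) : 0 < s -> s = 2 `^ (ln s / ln 2).
Proof.
move=> s0; rewrite /powR gt_eqF// mulfVK ?lnK ?posrE//.
by rewrite gt_eqF// ln_gt0// ltr1n.
Qed.

Lemma pow2_bracket (s : R) : 0 < s ->
  exists k : int, 2 `^ k%:~R <= s < 2 `^ (k + 1)%:~R.
Proof.
move=> s0; exists (Num.floor (ln s / ln 2)).
set L := ln s / ln 2; rewrite (pow2_log s0) -/L.
by rewrite ler_pow2 ltr_pow2 floor_itv.
Qed.

(** A dyadic interval is contained in a single dyadic interval of each larger
    length: [N <= u / 2 ^ j] compares [u] with the integer [N * 2 ^ j], hence only
    depends on the floor of [u]. *)
Lemma floor_div_pow2 (u v : R) (j : nat) : Num.floor u = Num.floor v ->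
  Num.floor (u / 2 ^+ j) = Num.floor (v / 2 ^+ j).
Proof.
have p0 : 0 < 2 ^+ j :> R by rewrite exprn_gt0.
suff H (a b : R) : Num.floor a = Num.floor b ->
    Num.floor (a / 2 ^+ j) <= Num.floor (b / 2 ^+ j).
  by move=> uv; apply/eqP; rewrite eq_le !H.
move=> ab; rewrite floor_ge_int ler_pdivlMr//.
have -> : (Num.floor (a / 2 ^+ j))%:~R * 2 ^+ j =
    (Num.floor (a / 2 ^+ j) * 2 ^+ j)%:~R :> R.
  by rewrite intrM rmorphXn.
rewrite -floor_ge_int -ab floor_ge_int intrM rmorphXn/=.
by rewrite -ler_pdivlMr// floor_le.
Qed.

End dyadic_scale.

Section dyadic.
Context {R : realType} {n : nat}.
Local Notation Rn := (euclidean R n).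
Local Notation mu := (@lebesgue R n).
Implicit Types (x y : Rn) (E : set Rn) (d : R).

(** The pair [(k, m)] stands for the half-open cube of side [2 ^ k] with corner
    [2 ^ k * m]. *)
Definition dyad := (int * {ffun 'I_n -> int})%type.
Implicit Types D P Q : dyad.

Definition dside D : R := 2 `^ D.1%:~R.

Definition dset D : set Rn :=
  [set x | forall i, Num.floor (coordinate x i / dside D) = D.2 i].

Definition dsub D Q := (D.1 <= Q.1) && `[< dset D `<=` dset Q >].

Lemma dside_gt0 D : 0 < dside D. Proof. exact: pow2_gt0. Qed.

Lemma dside_ge0 D : 0 <= dside D. Proof. exact/ltW/dside_gt0. Qed.

Lemma dyadic_nested D Q x : dset D x -> dset Q x -> D.1 <= Q.1 -> dsub D Q.
Proof.
move=> Dx Qx DQ; rewrite /dsub DQ; apply/asboolP => y Dy i.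
rewrite -(Qx i).
have [j Ej] : exists j : nat, Q.1 = D.1 + j.
  by exists `|Q.1 - D.1|%N; rewrite gez0_abs ?subr_ge0// subrKC.
have Es : dside Q = dside D * 2 ^+ j.
  by rewrite /dside Ej intrD pow2D -powR_mulrn.
rewrite Es !invfM !mulrA; apply: floor_div_pow2.
by rewrite Dx Dy.
Qed.

Lemma dyadic_eq D Q x : dset D x -> dset Q x -> D.1 = Q.1 -> D = Q.
Proof.
case: D Q => [k m] [k' m'] /= Dx Qx kk'; congr pair => //.
by apply/ffunP => i; rewrite -(Dx i) -(Qx i) /dside/= kk'.
Qed.

Lemma dyadic_meet D Q x : dset D x -> dset Q x -> dsub D Q || dsub Q D.
Proof.
move=> Dx Qx; have [DQ|/ltW QD] := leP D.1 Q.1.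
  by rewrite (dyadic_nested Dx Qx).
by rewrite (dyadic_nested Qx Dx) ?orbT.
Qed.

Definition dcorner D : Rn := [tuple (D.2 i)%:~R * dside D | i < n].

Lemma coordinate_tuple (F : 'I_n -> R) i :
  coordinate ([tuple F j | j < n] : Rn) i = F i.
Proof. by rewrite /coordinate tnth_mktuple. Qed.

Lemma dset_corner D : dset D (dcorner D).
Proof.
move=> i; rewrite coordinate_tuple mulfK ?gt_eqF ?dside_gt0//.
exact: intrKfloor.
Qed.

Definition dcube D : cube := Cube (dcorner D) (dside_gt0 D).

Lemma dset_sub_cube D : dset D `<=` dcube D.
Proof.
move=> x Dx i; rewrite /= coordinate_tuple -(Dx i).
have s0 := dside_gt0 D.
rewrite -ler_pdivlMr// floor_le/=.
rewrite -[X in _ <= _ + X]mul1r -mulrDl -ler_pdivrMr//.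
by rewrite ltW// -[1]/(1%:~R) -intrD floorD1_gt.
Qed.

Lemma dsub_refl D : dsub D D.
Proof. by rewrite /dsub lexx; apply/asboolP. Qed.

Lemma dsub_trans D P Q : dsub D P -> dsub P Q -> dsub D Q.
Proof.
move=> /andP[DP /asboolP sDP] /andP[PQ /asboolP sPQ].
by rewrite /dsub (le_trans DP)//; apply/asboolP; exact: subset_trans sPQ.
Qed.

Lemma dsub_set D Q : dsub D Q -> dset D `<=` dset Q.
Proof. by move=> /andP[_ /asboolP]. Qed.

Lemma dsub_side D Q : dsub D Q -> dside D <= dside Q.
Proof. by move=> /andP[DQ _]; rewrite ler_pow2 ler_int. Qed.

Lemma dsub_eq D Q : dsub D Q -> D.1 = Q.1 -> D = Q.
Proof.
by move=> DQ; apply: (@dyadic_eq _ _ (dcorner D));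
  [exact: dset_corner|exact/(dsub_set DQ)/dset_corner].
Qed.

Lemma dsub_total D P Q : dsub D P -> dsub D Q -> dsub P Q || dsub Q P.
Proof.
move=> DP DQ; apply: (@dyadic_meet _ _ (dcorner D));
  exact/(@dsub_set D)/dset_corner.
Qed.

Lemma measurable_dset D : measurable (dset D).
Proof.
have s0 := dside_gt0 D.
pose A i : set (measurableTypeR R) :=
  [set` `[(D.2 i)%:~R * dside D, (D.2 i + 1)%:~R * dside D[].
have [|mA _] := @borel_lebesgue_box R n A.
  by move=> i; exact: measurable_itv.
have -> : dset D = [set x | forall i, A i (tnth x i)].
  apply/seteqP; split=> x Dx i.
    rewrite /A /= in_itv/= -ler_pdivlMr// -ltr_pdivrMr//.
    by rewrite -(Dx i) floor_itv.
  move: (Dx i); rewrite /A /= in_itv/= -ler_pdivlMr// -ltr_pdivrMr// => xi.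
  by apply/eqP; rewrite floor_eq.
by apply: sub_caratheodory; exact: sub_sigma_algebra.
Qed.

Lemma lebesgue_dset D : (mu (dset D) <= (dside D `^ n%:R)%:E)%E.
Proof.
have [mQ Qn] := lebesgue_cube (dcube D).
rewrite powR_mulrn ?(ltW (dside_gt0 D))//.
rewrite (_ : dside D = side (dcube D))// -Qn.
by apply: le_measure; rewrite ?inE//; [exact: measurable_dset|exact: dset_sub_cube].
Qed.

(** A cube of side less than [2 ^ k] meets at most two dyadic intervals of length
    [2 ^ k] in every direction; [b] records which of them is taken. *)
Definition dcover_at (k : int) (Q : @cube R n) (b : {ffun 'I_n -> bool}) : dyad :=
  (k, [ffun i => Num.floor (coordinate (corner Q) i / 2 `^ k%:~R) + b i]).

Lemma dcover_atP (k : int) (Q : @cube R n) x : side Q < 2 `^ k%:~R ->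
  (Q : set Rn) x -> exists b, dset (dcover_at k Q b) x.
Proof.
move=> Qk Qx; set s : R := 2 `^ _ in Qk.
have s0 : 0 < s by exact: pow2_gt0.
exists [ffun i => Num.floor (coordinate x i / s) !=
  Num.floor (coordinate (corner Q) i / s)] => i.
rewrite /dside/= !ffunE -/s.
have [//|] := eqVneq (Num.floor (coordinate x i / s)); rewrite ?addr0//= => ne.
apply/eqP; rewrite eq_le; apply/andP; split; last first.
  rewrite lezD1 lt_neqAle eq_sym ne/= floor_ge_int.
  apply: le_trans (floor_le _) _; rewrite ler_pM2r ?invr_gt0//.
  by have /andP[] := Qx i.
rewrite -ltzD1 floor_lt_int intrD ltr_pdivrMr//.
have /andP[_ /le_lt_trans -> //] := Qx i.
rewrite mulrDl mul1r; apply: ler_ltD => //.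
by rewrite -ler_pdivrMr// ltW// floorD1_gt.
Qed.

Lemma dyadic_cover (Q : @cube R n) : exists Db : {ffun 'I_n -> bool} -> dyad,
  [/\ forall b, side Q < dside (Db b), forall b, dside (Db b) <= 2 * side Q &
      forall x, (Q : set Rn) x -> exists b, dset (Db b) x].
Proof.
have [k /andP[kQ Qk]] := pow2_bracket (side_gt0 Q).
exists (dcover_at (k + 1) Q); split=> [b|b|x]; [exact: Qk| |exact: dcover_atP].
by rewrite /dside/= intrD pow2D powRr1// mulrC ler_pM2l.
Qed.

Definition maximal (F : set dyad) : set dyad :=
  [set M | F M /\ forall N, F N -> dsub M N -> N = M].

(** The generations increase strictly along a chain of cubes above [D], and they
    are bounded by [K]. *)
Lemma maximal_exists (F : set dyad) (K : int) D :
  (forall P, F P -> P.1 <= K) -> F D -> exists2 M, maximal F M & dsub D M.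
Proof.
move=> FK FD; have [m] := ubnP `|K - D.1|%N.
elim: m D FD => // m ih D FD Dm.
have [Dmax|] := pselect (maximal F D); first by exists D => //; exact: dsub_refl.
move=> /not_andP[//|] /existsNP[N] /not_implyP[FN] /not_implyP[DN ND].
have DN1 : D.1 < N.1.
  case/andP: (DN) => + _; rewrite le_eqVlt => /predU1P[e|//].
  by case: ND; rewrite (dsub_eq DN e).
have [|M MM NM] := ih N FN; last by exists M => //; exact: dsub_trans NM.
have NK := FK _ FN; lia.
Qed.

Lemma maximal_unique (F : set dyad) D M N : maximal F M -> maximal F N ->
  dsub D M -> dsub D N -> M = N.
Proof.
move=> [FM MM] [FN NN] DM DN.
by have /orP[MN|NM] := dsub_total DM DN; [rewrite (MM N)|rewrite (NN M)].
Qed.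

End dyadic.

(** * Packings of dyadic cubes *)

Section packing.
Context {R : realType} {n : nat}.
Local Notation Rn := (euclidean R n).
Local Notation dyad := (@dyad n).
Local Notation dside := (@dside R n).
Local Notation dset := (@dset R n).
Local Notation dsub := (@dsub R n).
Local Notation maximal := (@maximal R n).
Implicit Types (x y : Rn) (E : set Rn) (d delta : R).
Implicit Types (D P Q : dyad) (S : seq dyad).

(** The Carleson packing condition in dimension [delta]. *)
Definition packed delta S := forall Q,
  \sum_(P <- S | dsub P Q) dside P `^ delta <= 2 * dside Q `^ delta.

Definition antichain S := {in S &, forall P Q, dsub P Q -> P = Q}.

(** The members inside of [Q] are not larger than [Q], so that each of them has a
    relative weight that decreases with the dimension. *)
Lemma packed_le delta d S : delta <= d -> packed delta S -> packed d S.
Proof.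
move=> dd pS Q.
have e P : dside P `^ d = dside P `^ (d - delta) * dside P `^ delta.
  by rewrite -powRD ?subrK// (gt_eqF (dside_gt0 P)) implybT.
rewrite (e Q) mulrCA.
apply: (@le_trans _ _ (dside Q `^ (d - delta) *
    \sum_(P <- S | dsub P Q) dside P `^ delta)); last first.
  by rewrite ler_wpM2l ?powR_ge0.
rewrite mulr_sumr; apply: ler_sum => P PQ; rewrite (e P).
apply: ler_wpM2r; first exact: powR_ge0.
apply: ge0_ler_powR; rewrite ?nnegrE ?dside_ge0 ?subr_ge0//.
exact: dsub_side.
Qed.

(** The side length of the intersection of two dyadic cubes. *)
Definition overlap P D : R :=
  if dsub D P then dside D else if dsub P D then dside P else 0.

Lemma overlap_ge0 P D : 0 <= overlap P D.
Proof.
rewrite /overlap; case: ifP => _; first exact: dside_ge0.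
by case: ifP => _ //; exact: dside_ge0.
Qed.

(** Either [D] lies inside of a member of the antichain, which is then the only one
    that it meets, or the members that it meets lie inside of [D] and the packing
    condition applies. *)
Lemma sum_overlap d S D : 0 < d -> uniq S -> antichain S -> packed d S ->
  \sum_(P <- S) overlap P D `^ d <= 2 * dside D `^ d.
Proof.
move=> d0 uS aS pS.
have [[P0 P0S DP0]|noP0] := pselect (exists2 P0, P0 \in S & dsub D P0).
  rewrite (bigD1_seq P0)//= big1_seq ?addr0.
    by rewrite /overlap DP0 ler_peMl ?powR_ge0// ler1n.
  move=> P /andP[PP0 PS]; rewrite /overlap; case: ifPn => [DP|_].
    have /orP[PP|PP] := dsub_total DP DP0.
      by move: PP0; rewrite (aS _ _ PS P0S PP) eqxx.
    by move: PP0; rewrite (aS _ _ P0S PS PP) eqxx.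
  case: ifPn => [PD|_]; last by rewrite powR0// gt_eqF.
  by move: PP0; rewrite (aS _ _ PS P0S (dsub_trans PD DP0)) eqxx.
apply: le_trans (pS D); rewrite [leRHS]big_mkcond/=.
rewrite big_seq [leRHS]big_seq; apply: ler_sum => P PS.
rewrite /overlap; case: ifPn => [DP|_].
  by case: noP0; exists P.
by case: ifPn => // _; rewrite powR0// gt_eqF.
Qed.

Lemma hcontent_overlap d P E (Q : nat -> cube)
    (D : nat -> {ffun 'I_n -> bool} -> dyad) :
  0 < d -> E `<=` \bigcup_j Q j ->
  (forall j x, (Q j : set Rn) x -> exists b, dset (D j b) x) ->
  (hcontent d (dset P `&` E) <=
   \esum_(i in [set: nat * {ffun 'I_n -> bool}]) (overlap P (D i.1 i.2) `^ d)%:E)%E.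
Proof.
move=> d0 EQ DQ.
apply: (hcontent_cover (c := fun i =>
    if dsub (D i.1 i.2) P then dcorner (D i.1 i.2) else dcorner P)) => //.
  by move=> i; exact: overlap_ge0.
move=> x [Px /EQ[j _ /DQ[b Dx]]]; exists (j, b) => [|i] /=; rewrite /overlap.
  case: ifPn => [_|DP]; rewrite ?dside_gt0//.
  by have := dyadic_meet Px Dx; rewrite (negbTE DP) orbF => ->; rewrite dside_gt0.
case: ifPn => [_|DP]; first exact: (dset_sub_cube Dx).
have := dyadic_meet Px Dx; rewrite (negbTE DP) orbF => ->.
exact: (dset_sub_cube Px).
Qed.

(** The content is not additive on disjoint sets, but it nearly is along a packed
    antichain: a cube of a cover of [E] that is smaller than the members it meets
    meets boundedly many of them, and the members inside a larger one are
    controlled by the packing condition. *)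
Lemma hcontent_packed d S E : 0 < d -> uniq S -> antichain S -> packed d S ->
  (\sum_(P <- S) hcontent d (dset P `&` E) <=
   (2 * 2 `^ d * 2 ^+ n)%:E * hcontent d E)%E.
Proof.
move=> d0 uS aS pS; set C := 2 * _ * _.
have C0 : 0 < C by rewrite !mulr_gt0 ?exprn_gt0 ?powR_gt0.
rewrite -lee_pdivrMl//; apply: le_ereal_inf_tmp => _ [Q EQ <-].
rewrite lee_pdivrMl//.
have /choice[D DP] j := dyadic_cover (Q j).
apply: (@le_trans _ _ (\sum_(P <- S)
  \esum_(i in [set: nat * {ffun 'I_n -> bool}]) (overlap P (D i.1 i.2) `^ d)%:E)%E).
  apply: lee_sum => P _; apply: (@hcontent_overlap d P E Q D d0 EQ) => j.
  by have [] := DP j.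
rewrite -esum_sum; last by move=> *; rewrite lee_fin powR_ge0.
apply: (@le_trans _ _ (\esum_(i in [set: nat * {ffun 'I_n -> bool}])
  (2 * 2 `^ d * side (Q i.1) `^ d)%:E)%E).
  apply: le_esum => -[j b] _ /=; rewrite sumEFin lee_fin.
  apply: le_trans (sum_overlap _ d0 uS aS pS) _.
  rewrite -mulrA ler_pM2l// -powRM ?ler0n ?(ltW (side_gt0 _))//.
  apply: ge0_ler_powR; rewrite ?nnegrE ?dside_ge0 ?(ltW d0)//.
    by rewrite mulr_ge0// ltW// side_gt0.
  by have [_ + _] := DP j; apply.
rewrite (_ : [set: nat * _] = [set: nat] `*`` (fun=> setT)); last first.
  by apply/seteqP; split.
rewrite -(esum_esum (a := fun j _ => (2 * 2 `^ d * side (Q j) `^ d)%:E)); last first.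
  by move=> *; rewrite lee_fin !mulr_ge0 ?powR_ge0.
rewrite nneseries_esumT; last by move=> j; rewrite lee_fin powR_ge0.
rewrite -esumZl; [|exact: ltW|by move=> j; rewrite lee_fin powR_ge0].
apply: le_esum => j _; rewrite esum_fin; last first.
  by move=> _; rewrite lee_fin !mulr_ge0 ?powR_ge0.
rewrite sumEFin -EFinM lee_fin sumr_const card_ffun card_bool card_ord.
by rewrite -[leLHS]mulr_natr natrX /C mulrAC.
Qed.

(** ** Covering a union of dyadic cubes at the cost of a packed subfamily *)

Section greedy_selection.
Context (F : set dyad) (delta : R) (delta0 : 0 < delta).

(** Every cube is examined once, in the order of the enumeration of all dyadic
    cubes, so that the selection is an increasing union of finite packed families.
    *)
Fixpoint greedy (k : nat) : seq dyad :=
  if k is j.+1 then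
    let S := greedy j in
    if unpickle j is Some P then
      if (P \notin S) && `[< F P /\ packed delta (P :: S) >] then P :: S else S
    else S
  else [::].

Lemma greedyS k : greedy k.+1 =
  if unpickle k is Some P then
    if (P \notin greedy k) && `[< F P /\ packed delta (P :: greedy k) >]
    then P :: greedy k else greedy k
  else greedy k.
Proof. by []. Qed.

Lemma greedyP k :
  [/\ uniq (greedy k), forall P, P \in greedy k -> F P & packed delta (greedy k)].
Proof.
elim: k => [|k [uk Fk pk]].
  by split=> // Q; rewrite big_nil mulr_ge0 ?powR_ge0.
rewrite greedyS.
case: (unpickle k) => // P; case: ifPn => // /andP[PS /asboolP[FP pP]].
split=> //=; first by rewrite PS.
by move=> Q; rewrite inE => /predU1P[->|/Fk].
Qed.

Lemma greedy_mono k l Q : (k <= l)%N ->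
  \sum_(P <- greedy k | dsub P Q) dside P `^ delta <=
  \sum_(P <- greedy l | dsub P Q) dside P `^ delta.
Proof.
elim: l => [|l ih]; first by rewrite leqn0 => /eqP ->.
rewrite leq_eqVlt => /predU1P[->//|/ih /le_trans]; apply.
rewrite greedyS; case: (unpickle l) => // P; case: ifPn => // _.
by rewrite big_cons; case: ifPn => // _; rewrite lerDr powR_ge0.
Qed.

(** Half of the budget of a full cube is used up: replacing the selected cubes
    inside of it by the cube itself does not increase the sum of the weights
    [l ^ delta]. *)
Definition full Q := exists k,
  dside Q `^ delta <= \sum_(P <- greedy k | dsub P Q) dside P `^ delta.

(** A cube is rejected only when adding it would overload some larger cube,
    which then is already full. *)
Lemma greedy_full P : F P -> exists2 Q, full Q & dsub P Q.
Proof.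
move=> FP; have [PS|PS] := boolP (P \in greedy (pickle P)).
  exists P; last exact: dsub_refl.
  exists (pickle P); rewrite (big_rem P PS)/= dsub_refl lerDl.
  by apply: sumr_ge0 => *; rewrite powR_ge0.
have [pP|] := pselect (packed delta (P :: greedy (pickle P))).
  exists P; last exact: dsub_refl.
  exists (pickle P).+1; rewrite greedyS pickleK PS andTb asboolT//.
  rewrite big_cons dsub_refl lerDl.
  by apply: sumr_ge0 => *; rewrite powR_ge0.
move=> /existsNP[Q /negP]; rewrite -ltNge big_cons => nQ.
have [_ _ pk] := greedyP (pickle P).
have PQ : dsub P Q.
  by apply: contraTT nQ => /negbTE ->; rewrite -leNgt.
exists Q => //; exists (pickle P); move: nQ; rewrite PQ => nQ.
have : dside P `^ delta <= dside Q `^ delta.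
  apply: ge0_ler_powR; rewrite ?nnegrE ?dside_ge0 ?(ltW delta0)//.
  exact: dsub_side.
set x := dside P `^ _ in nQ *; set y := dside Q `^ _ in nQ *.
by set z := (\sum_(_ <- _ | _) _) in nQ *; lra.
Qed.

Context (B : R)
  (total : forall k, \sum_(P <- greedy k) dside P `^ delta <= B).

Lemma full_le Q : full Q -> dside Q `^ delta <= B.
Proof.
move=> [k /le_trans ->//]; apply: le_trans (total k).
rewrite big_mkcond; apply: ler_sum => P _.
by case: ifP => // _; exact: powR_ge0.
Qed.

(** Each selected cube lies in at most one maximal full cube, so that its weight is
    charged only once. *)
Lemma sum_maximal_full (L : seq dyad) : uniq L ->
  (forall Q, Q \in L -> maximal full Q) ->
  \sum_(Q <- L) dside Q `^ delta <= B.
Proof.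
move=> uL mL.
(* Finitely many cubes are all full at a common stage of the selection. *)
have [k Lk] : exists k, forall Q, Q \in L ->
    dside Q `^ delta <= \sum_(P <- greedy k | dsub P Q) dside P `^ delta.
  elim: L mL {uL} => [|Q L ih] mL; first by exists 0%N.
  have [|k Lk] := ih; first by move=> P PL; apply: mL; rewrite inE PL orbT.
  have [|[l Ql] _] := mL Q; first by rewrite inE eqxx.
  exists (maxn k l) => P; rewrite inE => /predU1P[->|/Lk Pk].
    by apply: le_trans Ql _; exact/greedy_mono/leq_maxr.
  by apply: le_trans Pk _; exact/greedy_mono/leq_maxl.
apply: le_trans (total k).
apply: (@le_trans _ _ (\sum_(Q <- L)
    \sum_(P <- greedy k | dsub P Q) dside P `^ delta)).
  by rewrite big_seq [leRHS]big_seq; exact: ler_sum.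
under eq_bigr do rewrite big_mkcond/=.
rewrite exchange_big/=; apply: ler_sum => P _.
have [[Q0 Q0L PQ0]|noQ] := pselect (exists2 Q, Q \in L & dsub P Q).
  rewrite (bigD1_seq Q0)//= big1_seq ?addr0.
    by case: ifP => // _; exact: powR_ge0.
  move=> Q /andP[QQ0 QL]; case: ifPn => // PQ.
  by rewrite (maximal_unique (mL _ QL) (mL _ Q0L) PQ PQ0) eqxx in QQ0.
rewrite big1_seq ?powR_ge0// => Q /= QL; case: ifPn => // PQ.
by case: noQ; exists Q.
Qed.

End greedy_selection.

(** Points at distance at most [dside D] from the cube in the maximum norm: unlike
    a dilation, this neighbourhood is visibly monotone in [D]. *)
Definition dnbhd D : set Rn := [set y | exists2 x, dset D x &
  forall i, `|coordinate y i - coordinate x i| <= dside D].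

Lemma dnbhd_sub D Q : dsub D Q -> dnbhd D `<=` dnbhd Q.
Proof.
move=> DQ y [x Dx yx]; exists x; first exact: (dsub_set DQ).
by move=> i; apply: le_trans (yx i) _; exact: dsub_side.
Qed.

Lemma dnbhd_cube D y : dnbhd D y -> forall i : 'I_n,
  coordinate ([tuple coordinate (dcorner D) i - dside D | i < n] : Rn) i <=
  coordinate y i <=
  coordinate ([tuple coordinate (dcorner D) i - dside D | i < n] : Rn) i +
    3 * dside D.
Proof.
move=> [x /dset_sub_cube Dx yx] i; rewrite (coordinate_tuple (fun i => _)).
have /= := Dx i; have := yx i; rewrite ler_norml.
set a := coordinate _ _; set b := coordinate _ _; set c := coordinate _ _.
by set s := dside D; lra.
Qed.

Lemma dside_bounded delta (B : R) : 0 < delta ->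
  exists K : int, forall P, dside P `^ delta <= B -> P.1 <= K.
Proof.
move=> delta0; exists (Num.floor (ln B / ln 2 / delta)) => P PB.
have B0 : 0 < B by apply: lt_le_trans PB; rewrite powR_gt0// dside_gt0.
rewrite floor_ge_int ler_pdivlMr// -ler_pow2 -pow2_log//.
by rewrite powRrM.
Qed.

(** The maximal members of [F] form an antichain. The greedy selection among them
    satisfies the hypothesis, and the maximal full cubes, which cover [F], have no
    larger total weight than the selection. The factor [3 `^ delta] comes from the
    neighbourhoods. *)
Theorem hcontent_packing (F : set dyad) delta (B : R) : 0 < delta ->
  (forall S, uniq S -> (forall P, P \in S -> F P) -> antichain S ->
     packed delta S -> \sum_(P <- S) dside P `^ delta <= B) ->
  (hcontent delta (\bigcup_(P in F) dnbhd P) <= (3 `^ delta * B)%:E)%E.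
Proof.
move=> delta0 FB.
have [K BK] := dside_bounded B delta0.
have FK P : F P -> P.1 <= K.
  move=> FP; apply: BK.
  have := FB [:: P]; rewrite big_seq1; apply => //.
  - by move=> Q; rewrite inE => /eqP ->.
  - by move=> Q Q'; rewrite !inE => /eqP -> /eqP ->.
  - move=> Q; rewrite big_cons big_nil; case: ifPn => [PQ|_]; last first.
      by rewrite mulr_ge0 ?powR_ge0.
    rewrite addr0; apply: (@le_trans _ _ (dside Q `^ delta)).
      apply: ge0_ler_powR; rewrite ?nnegrE ?dside_ge0 ?(ltW delta0)//.
      exact: dsub_side.
    by rewrite ler_peMl ?powR_ge0// ler1n.
pose g := greedy (maximal F) delta.
have total k : \sum_(P <- g k) dside P `^ delta <= B.
  have [uk mk pk] := greedyP (maximal F) delta k.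
  apply: FB => // [P /mk[]//|P Q /mk mP /mk mQ PQ].
  exact: (maximal_unique mP mQ (dsub_refl P) PQ).
pose full := full (maximal F) delta.
pose M D := D \in [set D | maximal full D].
apply: (@le_trans _ _ (\esum_(D in [set: dyad])
    ((if M D then 3 * dside D else 0) `^ delta)%:E)%E).
  apply: (hcontent_cover
    (c := fun D => [tuple coordinate (dcorner D) i - dside D | i < n])) => //.
    by move=> D; case: ifP => // _; rewrite mulr_ge0// dside_ge0.
  move=> y [P FP Py].
  have [P' mP' PP'] := @maximal_exists R n F K P FK FP.
  have [Q fQ P'Q] := greedy_full delta0 mP'.
  have [|D mD QD] := @maximal_exists R n full K Q _ fQ.
    by move=> D /full_le-/(_ _ total)/BK.
  have MD : M D by apply/mem_set.
  exists D; rewrite MD; first by rewrite mulr_gt0// dside_gt0.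
  apply: dnbhd_cube.
  apply: (dnbhd_sub _ Py).
  exact: (dsub_trans PP' (dsub_trans P'Q QD)).
apply: esum_le => L uL; rewrite sumEFin lee_fin.
rewrite [leLHS](_ : _ = \sum_(D <- L | M D) (3 `^ delta * dside D `^ delta)).
  rewrite -mulr_sumr ler_pM2l ?powR_gt0// -big_filter.
  apply: (sum_maximal_full total); first exact: filter_uniq.
  by move=> D; rewrite mem_filter => /andP[/set_mem].
rewrite [RHS]big_mkcond/=; apply: eq_bigr => D _; case: ifP => _.
  by rewrite powRM ?dside_ge0.
by rewrite powR0// gt_eqF.
Qed.

End packing.

(** * Averages over cubes and the levels of the integrand *)

Section levels.
Context {R : realType}.

Lemma pow2_bracket_lt (s : R) : 0 < s ->
  exists k : int, 2 `^ k%:~R < s <= 2 `^ (k + 1)%:~R.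
Proof.
move=> s0; have [|k /andP[k1 k2]] := @pow2_bracket R s^-1; first by rewrite invr_gt0.
exists (- (k + 1)).
have -> : - (k + 1) + 1 = - k by rewrite opprD subrK.
rewrite !mulrNz !powRN; apply/andP; split.
  by rewrite -[ltRHS]invrK ltf_pV2// posrE ?powR_gt0// invr_gt0.
by rewrite -[leLHS]invrK lef_pV2// posrE ?powR_gt0// invr_gt0.
Qed.

Lemma twosided_le (eta c : R) (a : int -> \bar R) : 0 < eta -> 0 <= c ->
  (forall k, 0 <= a k)%E ->
  (forall k, (a k <= (c * 2 `^ (- (`|k|%:R * eta)))%:E)%E) ->
  (\esum_(k in [set: int]) a k <= (c * twosided eta)%:E)%E.
Proof.
move=> eta0 c0 a0 ac; rewrite EFinM -twosidedE// -esumZl//.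
by apply: le_esum => k _; rewrite -EFinM.
Qed.

Definition level (T : Type) (g : T -> \bar R) (t : R) : set T :=
  [set x | (t%:E < g x)%E].

(** The value of [g] at [x] is at most twice the height of the last level that
    contains [x]; an infinite value belongs to all levels, whose heights are
    unbounded. *)
Lemma le_sum_levels (T : Type) (g : T -> \bar R) (lam : R) x :
  0 < lam -> (0 <= g x)%E ->
  (g x <= \esum_(k in [set: int]) ((lam * 2 `^ (k + 1)%:~R)%:E *
     (\1_(level g (lam * 2 `^ k%:~R)) x)%:E))%E.
Proof.
move=> lam0 g0; set a := fun k : int => _.
have a0 k : (0 <= a k)%E.
  by rewrite mule_ge0// lee_fin ?mulr_ge0 ?powR_ge0// ltW.
have aE k : level g (lam * 2 `^ k%:~R) x -> a k = (lam * 2 `^ (k + 1)%:~R)%:E.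
  by move=> gx; rewrite /a indicE mem_set// mule1.
move: g0; case gx : (g x) => [u| |] //.
  rewrite lee_fin le_eqVlt => /predU1P[<-|u0].
    by apply: esum_ge0 => k _; exact: a0.
  have [|k /andP[ku uk]] := @pow2_bracket_lt (u / lam); first by rewrite divr_gt0.
  apply: le_trans (esum_term k a0); rewrite aE.
    by rewrite lee_fin mulrC -ler_pdivrMr.
  by rewrite /level/= gx lte_fin mulrC -ltr_pdivlMr.
move=> _; rewrite leye_eq; apply/eqP/eqyP => A A0.
have [|k /andP[_ Ak]] := @pow2_bracket_lt (A / lam); first by rewrite divr_gt0.
apply: le_trans (esum_term k a0); rewrite aE; last by rewrite /level/= gx ltry.
by rewrite lee_fin mulrC -ler_pdivrMr.
Qed.

Context d {T : measurableType d} (mu : {measure set T -> \bar R}).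

Lemma measurable_level (g : T -> \bar R) t : measurable_fun setT g ->
  measurable (level g t).
Proof.
by move=> mg; rewrite -[level g t]setTI; exact: emeasurable_fun_o_infty.
Qed.

(** It suffices to estimate each level separately as soon as the estimates decay
    geometrically on both sides of the height [lam]. *)
Lemma integral_levels (g : T -> \bar R) (Q : set T) (lam eta c : R) :
  0 < lam -> 0 < eta -> 0 <= c -> measurable Q ->
  measurable_fun setT g -> (forall x, 0 <= g x)%E ->
  (forall k : int, ((lam * 2 `^ (k + 1)%:~R)%:E *
     mu (Q `&` level g (lam * 2 `^ k%:~R)) <=
     (c * 2 `^ (- (`|k|%:R * eta)))%:E)%E) ->
  (\int[mu]_(x in Q) g x <= (c * twosided eta)%:E)%E.
Proof.
move=> lam0 eta0 c0 mQ mg g0 gc.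
pose F (k : int) x : \bar R := ((lam * 2 `^ (k + 1)%:~R)%:E *
  (\1_(level g (lam * 2 `^ k%:~R)) x)%:E)%E.
have l0 (k : int) : (0 <= (lam * 2 `^ (k + 1)%:~R)%:E)%E.
  by rewrite lee_fin mulr_ge0 ?powR_ge0// ltW.
have mI (k : int) : measurable_fun Q
    (fun x => (\1_(level g (lam * 2 `^ k%:~R)) x)%:E : \bar R).
  by apply/measurable_EFinP; apply: measurable_indic; exact: measurable_level.
apply: (@le_trans _ _ (\esum_(k in [set: int]) \int[mu]_(x in Q) F k x)%E).
  apply: le_integral_esum => //.
  - by apply: measurable_funTS.
  - by move=> k x; rewrite mule_ge0// lee_fin.
  - by move=> k; apply: measurable_funeM.
  - by move=> x _; exact: le_sum_levels.
apply: twosided_le => // k.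
  by apply: integral_ge0 => x _; rewrite mule_ge0// lee_fin.
rewrite /F ge0_integralZl//.
rewrite integral_indic; [|exact: mQ|exact: measurable_level].
rewrite setIC; exact: gc.
Qed.

End levels.

(** * Cubes with a large fractional average *)

Section fractional.
Context {R : realType} {n : nat} (d beta r p : R).
Context (d_gt0 : 0 < d) (d_le : d <= n%:R) (beta_ge0 : 0 <= beta)
  (beta_lt : beta < n%:R) (r_ge : d / n%:R <= r) (r_lt : r < p)
  (p_lt : beta * p < d).
Local Notation Rn := (euclidean R n).
Local Notation mu := (@lebesgue R n).
Local Notation dyad := (@dyad n).
Local Notation dside := (@dside R n).
Local Notation dset := (@dset R n).
Implicit Types (g : Rn -> \bar R) (D : dyad) (lam : R).

(** These exponents are imposed by scaling. For a normalised [g], fractional averages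
    of order [beta] of size [lam `^ height_exp] come from the values of [g] of size
    [lam], and the set where they occur has content of order [lam `^ (- decay_exp)]
    in dimension [target_dim]. *)
Definition height_exp := 1 - p * beta / d.
Definition target_dim := d - beta * r.
Definition decay_exp := p * target_dim / d.
(** The levels below [lam] decay at this rate because of the first bound; the second
    one leaves a decay of rate [sum_decay > 0] in the levels above [lam]. *)
Definition level_decay := Num.min height_exp ((p - r) / (2 * r)).
Definition sum_decay := p - r * (1 + level_decay).

Let n_gt0 : 0 < n%:R :> R. Proof. exact: lt_le_trans d_le. Qed.
Let r_gt0 : 0 < r. Proof. by apply: lt_le_trans r_ge; rewrite divr_gt0. Qed.
Let p_gt0 : 0 < p. Proof. exact: lt_trans r_lt. Qed.

Lemma height_exp_gt0 : 0 < height_exp.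
Proof. by rewrite subr_gt0 ltr_pdivrMr// mul1r mulrC. Qed.

Lemma target_dim_gt0 : 0 < target_dim.
Proof.
rewrite subr_gt0; apply: le_lt_trans p_lt.
by rewrite ler_wpM2l// ltW.
Qed.

Lemma decay_exp_gt0 : 0 < decay_exp.
Proof. by rewrite divr_gt0 ?mulr_gt0 ?target_dim_gt0. Qed.

Lemma level_decay_gt0 : 0 < level_decay.
Proof. by rewrite lt_min height_exp_gt0 divr_gt0 ?subr_gt0 ?mulr_gt0. Qed.

Lemma sum_decay_gt0 : 0 < sum_decay.
Proof.
have : level_decay <= (p - r) / (2 * r) by rewrite ge_min lexx orbT.
rewrite ler_pdivlMr ?mulr_gt0// => h; rewrite /sum_decay.
have -> : r * (1 + level_decay) = r + level_decay * (2 * r) / 2 by field.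
by move: r_lt h; lra.
Qed.

Definition normalized g := forall t, 0 < t ->
  (hcontent d (level g t) <= (t `^ (- p))%:E)%E.

(** A cube is heavy when the content of one of the levels of [g] inside of it is
    large, with a loss growing geometrically with the level. *)
Definition heavy g lam : set dyad := [set D | exists k : nat,
  ((lam `^ decay_exp * dside D `^ target_dim)%:E <=
   ((lam * 2 `^ k%:R) `^ p * 2 `^ (- (k%:R * sum_decay)))%:E *
   hcontent d (dset D `&` level g (lam * 2 `^ k%:R)))%E].

(** Below the height [lam] a level is estimated by its global content, above it
    by the content of its part inside of the cube. *)
Lemma light_level g lam D (k : int) : measurable_fun setT g -> normalized g ->
  0 < lam -> ~ heavy g lam D ->
  ((lam * 2 `^ (k + 1)%:~R)%:E * mu (dset D `&` level g (lam * 2 `^ k%:~R)) <=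
   (2 * lam `^ height_exp * dside D `^ (n%:R - beta) *
     2 `^ (- (`|k|%:R * level_decay)))%:E)%E.
Proof.
move=> mg ng lam0 Dlight.
set E := dset D `&` _.
have mE : measurable E.
  by apply: measurableI; [exact: measurable_dset|exact: measurable_level].
have El : (mu E <= (dside D `^ n%:R)%:E)%E.
  apply: le_trans (lebesgue_dset D); apply: le_measure; rewrite ?inE//.
    exact: measurable_dset.
  exact: subIsetl.
have [v [th [th01 Ev vth]]] : exists v th : R, [/\ 0 <= th <= 1,
    (hcontent d E <= v%:E)%E &
    lam * 2 `^ (k + 1)%:~R *
     (dside D `^ (n%:R * (1 - th)) * v `^ (n%:R / d * th)) <=
    2 * lam `^ height_exp * dside D `^ (n%:R - beta) * 2 `^ (- (`|k|%:R * level_decay))].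
  set L := ln lam / ln 2; have lamE : lam = 2 `^ L by exact: pow2_log.
  pose K : R := D.1%:~R.
  have sideE : dside D = 2 `^ K by [].
  have nn : n%:R != 0 :> R by rewrite gt_eqF.
  have dn : d != 0 by rewrite gt_eqF.
  have rn : r != 0 by rewrite gt_eqF.
  have two x y z : 2 * x * y * z = (2 : R) `^ 1 * x * y * z by rewrite powRr1.
  case: k @E mE El => k E mE El.
    (* The weight [th] turns the volume bound [l ^ n] and the content bound
       [v ^ (n / d)] into [l ^ (n - d / r) * v ^ (1 / r)]. *)
    have Hk : ~ ((lam `^ decay_exp * dside D `^ target_dim)%:E <=
        ((lam * 2 `^ k%:R) `^ p * 2 `^ (- (k%:R * sum_decay)))%:E * hcontent d E)%E.
      by move=> h; apply: Dlight; exists k.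
    exists (2 `^ (decay_exp * L + target_dim * K - p * (L + k%:R) + k%:R * sum_decay)).
    exists (d / (n%:R * r)).
    have c0 : 0 < (lam * 2 `^ k%:R) `^ p * 2 `^ (- (k%:R * sum_decay)).
      by rewrite mulr_gt0 ?powR_gt0// mulr_gt0// powR_gt0.
    have nr0 : 0 < n%:R * r by rewrite mulr_gt0.
    split.
    - apply/andP; split; first by rewrite ltW// divr_gt0.
      by rewrite ler_pdivrMr// mul1r mulrC -ler_pdivrMr.
    - move/negP : Hk; rewrite -ltNge => /ltW; rewrite -lee_pdivlMl// => /le_trans.
      apply; rewrite -EFinM lee_fin ler_pdivrMl// lamE sideE.
      rewrite -!powRrM -!pow2D -!powRrM -!pow2D ler_pow2 le_eqVlt.
      by apply/orP; left; apply/eqP; ring.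
    - rewrite two lamE sideE -!powRrM -!pow2D ler_pow2 intrD absz_nat -pmulrn.
      rewrite le_eqVlt; apply/orP; left; apply/eqP.
      rewrite /decay_exp /target_dim /height_exp /sum_decay; field.
      by rewrite dn rn nn.
  (* Here [th] is chosen such that the power of the side is [n - beta], the one
     that a fractional average of order [beta] compensates. *)
  set k' : R := (Negz k)%:~R.
  have k'E : `|Negz k|%:R = - k' by rewrite /k' NegzE abszN mulrNz opprK.
  have k'0 : k' <= 0 by rewrite -oppr_ge0 -k'E.
  have eg : level_decay <= height_exp by rewrite ge_min lexx.
  exists (2 `^ (- p * (L + k'))), (beta / n%:R); split.
  - by rewrite divr_ge0 ?ler0n//= ler_pdivrMr// mul1r ltW.
  - apply: (@le_trans _ _ (hcontent d (level g (lam * 2 `^ k')))).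
      by apply: le_hcontent; exact: subIsetr.
    apply: le_trans (ng _ _) _; first by rewrite mulr_gt0// powR_gt0.
    by rewrite lee_fin lamE -pow2D -powRrM mulrC.
  - rewrite two lamE sideE -!powRrM -!pow2D ler_pow2 intrD k'E.
    have -> : L + (k' + 1%:~R) +
       (K * (n%:R * (1 - beta / n%:R)) + - p * (L + k') * (n%:R / d * (beta / n%:R)))
       = 1 + height_exp * L + K * (n%:R - beta) + height_exp * k'.
      by rewrite /height_exp; field; rewrite nn dn.
    by rewrite mulrC lerD2l mulNr opprK mulrC ler_wnM2l.
apply: le_trans (_ : (_ <= (lam * 2 `^ (k + 1)%:~R)%:E *
    (dside D `^ (n%:R * (1 - th)) * v `^ (n%:R / d * th))%:E)%E) _.
  apply: lee_wpmul2l; first by rewrite lee_fin mulr_ge0 ?powR_ge0// ltW.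
  by apply: lebesgue_interp => //; exact: dside_ge0.
by rewrite -EFinM lee_fin.
Qed.

Lemma light_integral g lam D : measurable_fun setT g ->
  (forall x, 0 <= g x)%E -> normalized g -> 0 < lam -> ~ heavy g lam D ->
  (\int[mu]_(x in dset D) g x <=
   (2 * lam `^ height_exp * dside D `^ (n%:R - beta) * twosided level_decay)%:E)%E.
Proof.
move=> mg g0 ng lam0 Dlight; apply: (integral_levels lam0 level_decay_gt0) => //.
- by rewrite !mulr_ge0 ?powR_ge0.
- exact: measurable_dset.
- by move=> k; exact: light_level.
Qed.

Definition bigavg g (t : R) : set Rn := [set x | exists2 Q : cube,
  (Q : set Rn) x &
  (t%:E < (side Q `^ (beta - n%:R))%:E * \int[mu]_(y in Q) g y)%E].

Definition bigavg_cst := 2 ^+ n * 2 `^ (n%:R - beta) * (2 * twosided level_decay).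

Lemma bigavg_cst_gt0 : 0 < bigavg_cst.
Proof. by rewrite !mulr_gt0 ?exprn_gt0 ?powR_gt0// twosided_gt0// level_decay_gt0. Qed.

(** A cube is covered by [2 ^ n] dyadic cubes of comparable side that meet it. If
    none of them is heavy, all the integrals over them are small. *)
Lemma bigavg_heavy g lam : measurable_fun setT g -> (forall x, 0 <= g x)%E ->
  normalized g -> 0 < lam ->
  bigavg g (bigavg_cst * lam `^ height_exp) `<=`
  \bigcup_(D in heavy g lam) dnbhd (R := R) D.
Proof.
move=> mg g0 ng lam0 x [Q Qx]; rewrite ltNge; apply: contraNP => nheavy.
have l0 := side_gt0 Q.
have [D [QD DQ Dcov]] := dyadic_cover Q.
have [mQ _] := lebesgue_cube Q.
pose c := 2 * lam `^ height_exp * (2 * side Q) `^ (n%:R - beta) * twosided level_decay.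
have t0 : 0 < twosided level_decay by rewrite twosided_gt0// level_decay_gt0.
have intb b : (\int[mu]_(y in (Q : set Rn)) (g \_ (dset (D b))) y <= c%:E)%E.
  rewrite -integral_mkcondr.
  have [[z [Qz Dz]]|noz] := pselect (exists z, ((Q : set Rn) `&` dset (D b)) z);
    last first.
    rewrite (_ : _ `&` _ = set0); last first.
      by apply/seteqP; split => // z Hz; case: noz; exists z.
    by rewrite integral_set0 lee_fin /c !mulr_ge0 ?powR_ge0// ltW.
  have Db : ~ heavy g lam (D b).
    move=> hD; apply: nheavy; exists (D b) => //; exists z => // i.
    apply: (@le_trans _ _ (side Q)); last exact: ltW.
    have := Qx i; have := Qz i; rewrite ler_norml.
    set u := coordinate _ _; set v := coordinate _ _; set w := coordinate _ _.
    by set s := side Q; lra.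
  apply: (@le_trans _ _ (\int[mu]_(y in dset (D b)) g y)%E).
    apply: ge0_subset_integral => //.
    - by apply: measurableI => //; exact: measurable_dset.
    - exact: measurable_dset.
    - exact: measurable_funTS.
  apply: le_trans (light_integral mg g0 ng lam0 Db) _.
  rewrite lee_fin /c ler_pM2r// ler_wpM2l ?mulr_ge0 ?powR_ge0//.
  apply: ge0_ler_powR; rewrite ?nnegrE ?dside_ge0//.
  - by rewrite subr_ge0 ltW.
  - by rewrite mulr_ge0// ltW.
rewrite -lee_pdivlMl ?powR_gt0//.
apply: (@le_trans _ _ (\esum_(b in [set: {ffun 'I_n -> bool}])
    \int[mu]_(y in (Q : set Rn)) (g \_ (dset (D b))) y)%E).
  apply: le_integral_esum; [exact: mQ|exact: g0|exact: measurable_funTS| | |].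
  - by move=> b y; exact: erestrict_ge0.
  - move=> b; apply: measurable_funTS.
    apply: (measurable_restrictT _ (measurable_dset (D b))).1.
    exact: measurable_funTS.
  - move=> y Qy; have [b Dy] := Dcov y Qy.
    apply: le_trans (esum_term b _).
      by rewrite patchE mem_set.
    by move=> b'; exact: erestrict_ge0.
rewrite esum_fin; last by move=> b; apply: integral_ge0 => y _; exact: erestrict_ge0.
apply: (@le_trans _ _ (\sum_(b : {ffun 'I_n -> bool}) c%:E)%E).
  by apply: lee_sum => b _; exact: intb.
rewrite sumEFin -EFinM lee_fin sumr_const card_ffun card_bool card_ord.
rewrite -powRN opprB -[leLHS]mulr_natr natrX /c /bigavg_cst powRM ?(ltW l0)//.
rewrite le_eqVlt; apply/orP; left; apply/eqP; ring.
Qed.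

Definition level_sum (kappa : R) g lam : \bar R := (\esum_(k in [set: nat])
  ((lam * 2 `^ k%:R) `^ p * 2 `^ (- (k%:R * kappa)))%:E *
  hcontent d (level g (lam * 2 `^ k%:R)))%E.

(** By normalisation, each content is at most the inverse of its weight, which
    leaves a geometric series. *)
Lemma level_sum_le kappa g lam : 0 < kappa -> normalized g -> 0 < lam ->
  (level_sum kappa g lam <= (twosided kappa)%:E)%E.
Proof.
move=> kappa0 ng lam0; rewrite -twosidedE//.
apply: (@esum_sub R int nat _ Posz) => //.
- by move=> i j _ _ [].
- move=> k _; have lk : 0 < lam * 2 `^ k%:R by rewrite mulr_gt0// powR_gt0.
  rewrite muleC; apply: le_trans (_ : _ <= ((lam * 2 `^ k%:R) `^ (- p))%:E *
    ((lam * 2 `^ k%:R) `^ p * 2 `^ (- (k%:R * kappa)))%:E)%E _.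
    by apply: lee_wpmul2r; [rewrite lee_fin mulr_ge0 ?powR_ge0|exact: ng].
  by rewrite -EFinM mulrA -powRD ?addNr ?powRr0 ?mul1r// (gt_eqF lk) implybT.
Qed.

(** The neighbourhoods of the heavy cubes cover the set. Along a packed antichain of
    heavy cubes, the weights are bounded by the contents of the pieces of the levels
    above [lam], and these add up by [hcontent_packed]. *)
Theorem hcontent_bigavg g lam : measurable_fun setT g ->
  (forall x, 0 <= g x)%E -> normalized g -> 0 < lam ->
  (hcontent target_dim (bigavg g (bigavg_cst * lam `^ height_exp)) <=
   (3 `^ target_dim * (2 * 2 `^ d * 2 ^+ n) * lam `^ (- decay_exp))%:E *
    level_sum sum_decay g lam)%E.
Proof.
move=> mg g0 ng lam0; set Cp := 2 * 2 `^ d * 2 ^+ n.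
apply: le_trans (le_hcontent _ (bigavg_heavy mg g0 ng lam0)) _.
have ls0 : (0 <= level_sum sum_decay g lam)%E.
  apply: esum_ge0 => k _.
  by rewrite mule_ge0 ?hcontent_ge0// lee_fin mulr_ge0 ?powR_ge0.
have lsE : level_sum sum_decay g lam = (fine (level_sum sum_decay g lam))%:E.
  rewrite fineK// ge0_fin_numE//.
  exact: le_lt_trans (level_sum_le sum_decay_gt0 ng lam0) (ltry _).
rewrite lsE -EFinM (_ : _ * _ * _ * _ = 3 `^ target_dim *
  (lam `^ (- decay_exp) * (Cp * fine (level_sum sum_decay g lam)))); last by ring.
apply: hcontent_packing; first exact: target_dim_gt0.
move=> S uS hS aS pS.
have pS' : packed d S.
  by apply: packed_le pS; rewrite /target_dim lerBlDr lerDl mulr_ge0// ltW.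
rewrite powRN ler_pdivlMl ?powR_gt0//.
rewrite -lee_fin (EFinM Cp) -lsE /level_sum.
apply: (@le_trans _ _ (\sum_(D <- S) \esum_(k in [set: nat])
  (((lam * 2 `^ k%:R) `^ p * 2 `^ (- (k%:R * sum_decay)))%:E *
   hcontent d (dset D `&` level g (lam * 2 `^ k%:R))))%E).
  rewrite mulr_sumr -sumEFin big_seq [leRHS]big_seq.
  apply: lee_sum => D /hS[k /le_trans]; apply.
  apply: (esum_term (a := fun k : nat =>
    (((lam * 2 `^ k%:R) `^ p * 2 `^ (- (k%:R * sum_decay)))%:E *
     hcontent d (dset D `&` level g (lam * 2 `^ k%:R)))%E)) => j.
  by rewrite mule_ge0 ?hcontent_ge0// lee_fin mulr_ge0 ?powR_ge0.
rewrite -esum_sum; last first.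
  by move=> *; rewrite mule_ge0 ?hcontent_ge0// lee_fin mulr_ge0 ?powR_ge0.
rewrite -esumZl//; last first.
- by move=> *; rewrite mule_ge0 ?hcontent_ge0// lee_fin mulr_ge0 ?powR_ge0.
- by rewrite !mulr_ge0 ?powR_ge0 ?exprn_ge0.
apply: le_esum => k _; rewrite -ge0_sume_distrr; last first.
  by move=> *; exact: hcontent_ge0.
rewrite muleCA; apply: lee_wpmul2l; first by rewrite lee_fin mulr_ge0 ?powR_ge0.
exact: hcontent_packed.
Qed.

End fractional.

(** * The fractional integral *)

Section riesz.
Context {R : realType} {n : nat}.
Local Notation Rn := (euclidean R n).
Local Notation mu := (@lebesgue R n).
Implicit Types (g : Rn -> \bar R) (x y : Rn) (lam s : R).

Lemma measurable_coordinate i : measurable_fun setT (@coordinate R n ^~ i).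
Proof.
move=> _ B mB; rewrite setTI.
apply: sub_caratheodory; apply: sub_sigma_algebra.
rewrite -[X in measurable X]setTI.
exact: (@measurable_tnth _ _ n i measurableT B mB).
Qed.

Lemma measurable_euclidean_dist x : measurable_fun setT (euclidean_dist x).
Proof.
rewrite /euclidean_dist.
apply: (@measurableT_comp _ _ _ _ _ _ (@Num.sqrt R)).
  by apply: continuous_measurable_fun; exact: sqrt_continuous.
apply: measurable_sum => i; apply: measurable_funX.
by apply: measurable_funB; [exact: measurable_cst|exact: measurable_coordinate].
Qed.

Lemma coordinate_dist x y i :
  `|coordinate x i - coordinate y i| <= euclidean_dist x y.
Proof.
rewrite -sqrtr_sqr ler_sqrt; last by apply: sumr_ge0 => j _; rewrite sqr_ge0.
by rewrite (bigD1 i)//= lerDl; apply: sumr_ge0 => j _; rewrite sqr_ge0.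
Qed.

(** The levels are taken around the height [side Q `^ (- (d / p))], where the content
    of a level of a normalised function balances the content of [Q]: below it the
    volume of [Q] is used, above it the volume is bounded by the content. *)
Lemma integral_cube_normalized (d p : R) g (Q : cube) :
  0 < d -> d <= n%:R -> d / n%:R < p ->
  measurable_fun setT g -> (forall y, 0 <= g y)%E -> normalized d p g ->
  (\int[mu]_(y in (Q : set Rn)) g y <=
   (2 * twosided (Num.min 1 (p * n%:R / d - 1)) *
    side Q `^ (n%:R - d / p))%:E)%E.
Proof.
move=> d0 dn pd mg g0 ng; set eta := Num.min _ _.
have n0 : 0 < n%:R :> R by exact: lt_le_trans dn.
have p0 : 0 < p by apply: lt_trans pd; rewrite divr_gt0.
have l0 := side_gt0 Q; have [mQ Qn] := lebesgue_cube Q.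
pose lam := side Q `^ (- (d / p)).
have lam0 : 0 < lam by rewrite powR_gt0.
have eta0 : 0 < eta.
  by rewrite lt_min ltr01 subr_gt0 ltr_pdivlMr// mul1r -ltr_pdivrMr.
rewrite mulrAC.
apply: (integral_levels lam0 eta0) => //; first by rewrite mulr_ge0 ?powR_ge0.
move=> k.
set E := (Q : set Rn) `&` _.
have mE : measurable E by apply: measurableI => //; exact: measurable_level.
have El : (mu E <= (side Q `^ n%:R)%:E)%E.
  rewrite powR_mulrn ?(ltW l0)// -Qn; apply: le_measure; rewrite ?inE//.
  exact: subIsetl.
have Ev : (hcontent d E <= ((lam * 2 `^ k%:~R) `^ (- p))%:E)%E.
  apply: le_trans (le_hcontent _ (@subIsetr _ _ _)) _.
  by apply: ng; rewrite mulr_gt0// powR_gt0.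
set L := ln (side Q) / ln 2; have lE : side Q = 2 `^ L by exact: pow2_log.
have [th [th01 thk]] : exists th : R, 0 <= th <= 1 /\
    lam * 2 `^ (k + 1)%:~R *
    (side Q `^ (n%:R * (1 - th)) *
     ((lam * 2 `^ k%:~R) `^ (- p)) `^ (n%:R / d * th)) <=
    2 * side Q `^ (n%:R - d / p) * 2 `^ (- (`|k|%:R * eta)).
  have two (u w : R) : 2 * u * w = (2 : R) `^ 1 * u * w by rewrite powRr1.
  have [k0|k0] := leP 0 k.
    (* Above the height [lam], only the content of the level is used. *)
    exists 1; split; first by rewrite ler01 lexx.
    rewrite two /lam lE -!powRrM -!pow2D -!powRrM -!pow2D ler_pow2 intrD.
    have -> : `|k|%:R = k%:~R :> R by rewrite pmulrn gez0_abs.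
    have kR : 0 <= k%:~R :> R by rewrite ler0z.
    have : k%:~R * eta <= k%:~R * (p * n%:R / d - 1).
      by rewrite ler_wpM2l// ge_min lexx orbT.
    set K := k%:~R; set z := K * eta.
    have -> : L * (- (d / p)) + (K + 1%:~R) + (L * (n%:R * (1 - 1)) +
      (L * (- (d / p)) + K) * (- p * (n%:R / d * 1))) =
      1 + L * (n%:R - d / p) - K * (p * n%:R / d - 1).
      by field; rewrite !gt_eqF.
    by lra.
  (* Below the height [lam], only the volume of [Q] is used. *)
  exists 0; split; first by rewrite ler01 lexx.
  rewrite two /lam lE -!powRrM -!pow2D -!powRrM -!pow2D ler_pow2 intrD.
  have -> : `|k|%:R = - k%:~R :> R by rewrite pmulrn ltz0_abs// mulrNz.
  have kR : k%:~R <= 0 :> R by rewrite lerz0 ltW.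
  have : k%:~R * 1 <= k%:~R * eta by rewrite ler_wnM2l// ge_min lexx.
  set K := k%:~R; set z := K * eta.
  rewrite subr0 !mulr0 addr0 mulr1 mulNr -/z.
  by set u := d / p; lra.
apply: le_trans (_ : (_ <= (lam * 2 `^ (k + 1)%:~R)%:E *
    (side Q `^ (n%:R * (1 - th)) *
     ((lam * 2 `^ k%:~R) `^ (- p)) `^ (n%:R / d * th))%:E)%E) _.
  apply: lee_wpmul2l; first by rewrite lee_fin mulr_ge0 ?powR_ge0.
  by apply: lebesgue_interp => //; exact: ltW.
by rewrite -EFinM lee_fin.
Qed.

Definition ccube x l (l0 : 0 < l) : cube :=
  Cube ([tuple coordinate x i - l / 2 | i < n] : Rn) l0.

Lemma ccubeP x l (l0 : 0 < l) y :
  (forall i, `|coordinate x i - coordinate y i| <= l / 2) ->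
  (ccube x l0 : set Rn) y.
Proof.
move=> xy i; rewrite /= (coordinate_tuple (fun i => _)).
have := xy i; rewrite ler_norml.
by set a := coordinate _ _; set b := coordinate _ _; lra.
Qed.

Lemma scale_gt0 s (k : int) : 0 < s -> 0 < s * 2 `^ k%:~R.
Proof. by move=> s0; rewrite mulr_gt0// powR_gt0. Qed.

Definition kernel alpha x y : R := (euclidean_dist x y `^ (n%:R - alpha))^-1.

Lemma kernel_ge0 alpha x y : 0 <= kernel alpha x y.
Proof. by rewrite invr_ge0 powR_ge0. Qed.

(** The cubes centred at [x] of sides [s * 2 ^ k] exhaust the space, and the kernel
    is comparable to a power of the side on their successive differences; it is [0]
    on the diagonal. *)
Lemma kernel_le alpha x y s (s0 : 0 < s) : alpha < n%:R ->
  kernel alpha x y = 0 \/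
  exists2 k : int, (ccube x (scale_gt0 k s0) : set Rn) y &
   kernel alpha x y <= 4 `^ (n%:R - alpha) * (s * 2 `^ k%:~R) `^ (alpha - n%:R).
Proof.
move=> an; have na : n%:R - alpha != 0 by rewrite gt_eqF// subr_gt0.
have : 0 <= euclidean_dist x y by rewrite sqrtr_ge0.
rewrite /kernel le_eqVlt => /predU1P[<-|rho0].
  by left; rewrite powR0// invr0.
right; have [|m /andP[m1 m2]] := @pow2_bracket_lt R (2 * euclidean_dist x y / s).
  by rewrite divr_gt0// mulr_gt0.
move: m1 m2; rewrite ltr_pdivlMr// ler_pdivrMr// => m1 m2.
exists (m + 1).
  apply: ccubeP => i; apply: le_trans (coordinate_dist _ _ _) _.
  by rewrite ler_pdivlMr// mulrC (le_trans m2)// mulrC.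
rewrite -(opprB n%:R alpha) powRN ler_pdivlMr ?powR_gt0 ?scale_gt0//.
rewrite ler_pdivrMl ?powR_gt0// -powRM ?(ltW rho0)//.
apply: ge0_ler_powR; rewrite ?nnegrE ?subr_ge0 ?(ltW an)//.
- exact/ltW/scale_gt0.
- by rewrite mulr_ge0// ltW.
- by rewrite intrD pow2D powRr1//; move: m1; lra.
Qed.

Lemma measurable_kernel alpha x : measurable_fun setT (kernel alpha x).
Proof.
have -> : kernel alpha x =
    (fun u : R => u `^ (- (n%:R - alpha))) \o euclidean_dist x.
  by apply/funext => y; rewrite /kernel/= powRN.
apply: measurableT_comp; first exact: measurable_powR.
exact: measurable_euclidean_dist.
Qed.

Lemma integral_kernel_le alpha g x s (s0 : 0 < s) : alpha < n%:R ->
  measurable_fun setT g -> (forall y, 0 <= g y)%E ->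
  (\int[mu]_y (g y * (kernel alpha x y)%:E) <= \esum_(k in [set: int])
   ((4 `^ (n%:R - alpha) * (s * 2 `^ k%:~R) `^ (alpha - n%:R))%:E *
    \int[mu]_(y in (ccube x (scale_gt0 k s0) : set Rn)) g y))%E.
Proof.
move=> an mg g0.
pose c (k : int) := 4 `^ (n%:R - alpha) * (s * 2 `^ k%:~R) `^ (alpha - n%:R).
have c0 k : 0 <= c k by rewrite mulr_ge0 ?powR_ge0.
pose Q k : set Rn := ccube x (scale_gt0 k s0).
have mQ k : measurable (Q k) by have [] := lebesgue_cube (ccube x (scale_gt0 k s0)).
have mgQ k : measurable_fun setT (g \_ (Q k)).
  apply: (measurable_restrictT _ (mQ k)).1; exact: measurable_funTS.
have gQ0 k y : (0 <= (g \_ (Q k)) y)%E by exact: erestrict_ge0.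
apply: (@le_trans _ _ (\esum_(k in [set: int])
    \int[mu]_y ((c k)%:E * (g \_ (Q k)) y))%E).
  apply: le_integral_esum.
  - exact: measurableT.
  - by move=> y; rewrite mule_ge0// lee_fin kernel_ge0.
  - apply: emeasurable_funM; first exact: mg.
    by apply/measurable_EFinP; exact: measurable_kernel.
  - by move=> k y; rewrite mule_ge0// lee_fin c0.
  - by move=> k; apply: measurable_funeM.
  - move=> y _.
    have T0 k : (0 <= (c k)%:E * (g \_ (Q k)) y)%E.
      by rewrite mule_ge0// lee_fin c0.
    have [->|[k Qy kc]] := kernel_le x y s0 an.
      by rewrite mule0; apply: esum_ge0 => k _; exact: T0.
    apply: le_trans (esum_term k T0); rewrite patchE mem_set// muleC.
    by apply: lee_wpmul2r; [exact: g0|rewrite lee_fin].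
apply: le_esum => k _.
rewrite ge0_integralZl//; last by rewrite lee_fin c0.
by rewrite [in leRHS]integral_mkcond.
Qed.

Context (d alpha r p : R).
Context (d_gt0 : 0 < d) (d_le : d <= n%:R) (alpha_gt0 : 0 < alpha)
  (alpha_lt : alpha < n%:R) (r_ge : d / n%:R <= r) (r_lt : r < p)
  (p_lt : alpha * p < d).

(** The order [lower_order] is slightly smaller than [alpha], and [lower_index] is
    chosen such that [lower_order * lower_index = alpha * r]: the target dimension is
    the same for the
    pairs [(alpha, r)] and [(lower_order, lower_index)]. *)
Definition order_gap := Num.min (alpha * (p - r) / (2 * p)) (d / p - alpha).
Definition lower_order := alpha - order_gap.
Definition lower_index := alpha * r / lower_order.

Let n_gt0 : 0 < n%:R :> R. Proof. exact: lt_le_trans d_le. Qed.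
Let r_gt0 : 0 < r. Proof. by apply: lt_le_trans r_ge; rewrite divr_gt0. Qed.
Let p_gt0 : 0 < p. Proof. exact: lt_trans r_lt. Qed.

Lemma order_gap_gt0 : 0 < order_gap.
Proof.
rewrite lt_min divr_gt0 ?mulr_gt0 ?subr_gt0//=.
by rewrite ltr_pdivlMr.
Qed.

Let order_gap_le : order_gap <= alpha * (p - r) / (2 * p).
Proof. by rewrite ge_min lexx. Qed.

Let lower_order_ge : alpha * (p + r) / (2 * p) <= lower_order.
Proof.
have -> : alpha * (p + r) / (2 * p) = alpha - alpha * (p - r) / (2 * p).
  by field; rewrite gt_eqF.
by rewrite /lower_order lerD2l lerN2.
Qed.

Lemma lower_order_gt0 : 0 < lower_order.
Proof.
apply: lt_le_trans lower_order_ge.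
by rewrite divr_gt0 ?mulr_gt0 ?addr_gt0.
Qed.

Lemma lower_order_lt : lower_order < alpha.
Proof. by rewrite /lower_order ltrBlDr ltrDl order_gap_gt0. Qed.

Lemma lower_index_ge : d / n%:R <= lower_index.
Proof.
apply: le_trans r_ge _; rewrite /lower_index ler_pdivlMr ?lower_order_gt0// mulrC.
by rewrite ler_pM2r// ltW// lower_order_lt.
Qed.

Lemma lower_index_lt : lower_index < p.
Proof.
rewrite /lower_index ltr_pdivrMr ?lower_order_gt0//.
apply: lt_le_trans (_ : p * (alpha * (p + r) / (2 * p)) <= _); last first.
  by rewrite ler_pM2l.
have -> : p * (alpha * (p + r) / (2 * p)) = alpha * ((p + r) / 2).
  by field; rewrite gt_eqF.
by rewrite ltr_pM2l//; move: r_lt; lra.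
Qed.

Lemma lower_order_p_lt : lower_order * p < d.
Proof. by apply: lt_trans p_lt; rewrite ltr_pM2r// lower_order_lt. Qed.

Lemma target_dim_lower : target_dim d lower_order lower_index = target_dim d alpha r.
Proof.
by rewrite /target_dim /lower_index [X in _ - X]mulrC mulfVK// gt_eqF// lower_order_gt0.
Qed.

Definition riesz_avg_cst := 2 * twosided (Num.min 1 (p * n%:R / d - 1)).

Definition riesz_cst := 4 `^ (n%:R - alpha) *
  Num.max (bigavg_cst (n := n) d lower_order lower_index p) riesz_avg_cst *
  twosided order_gap.

Lemma riesz_cst_gt0 : 0 < riesz_cst.
Proof.
rewrite mulr_gt0 ?mulr_gt0 ?powR_gt0 ?twosided_gt0 ?order_gap_gt0//.
rewrite lt_max bigavg_cst_gt0//.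
- exact: lower_index_ge.
- exact: lower_index_lt.
- exact: lower_order_p_lt.
Qed.

(** Outside of the set where the fractional maximal function of order [lower_order] is
    large, small cubes around [x] are controlled by the latter, and large ones by
    the normalisation of [g]; both bounds decay geometrically away from the side
    [lam `^ (- (p / d))]. *)
Theorem riesz_pointwise g lam x : measurable_fun setT g ->
  (forall y, 0 <= g y)%E -> normalized d p g -> 0 < lam ->
  ((riesz_cst * lam `^ height_exp d alpha p)%:E <
    \int[mu]_y (g y * (kernel alpha x y)%:E))%E ->
  bigavg lower_order g (bigavg_cst (n := n) d lower_order lower_index p *
    lam `^ height_exp d lower_order p) x.
Proof.
move=> mg g0 ng lam0; apply: contraPP => xsmall; apply/negP; rewrite -leNgt.
set C0 := bigavg_cst _ _ _ _ in xsmall *.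
have C00 : 0 < C0.
  apply: bigavg_cst_gt0 => //.
  - exact: lower_index_ge.
  - exact: lower_index_lt.
  - exact: lower_order_p_lt.
have s0 : 0 < lam `^ (- (p / d)) by rewrite powR_gt0.
apply: le_trans (integral_kernel_le x s0 alpha_lt mg g0) _.
set M := Num.max C0 riesz_avg_cst.
have M0 : 0 < M by rewrite lt_max C00.
have -> : riesz_cst * lam `^ height_exp d alpha p =
    (4 `^ (n%:R - alpha) * M * lam `^ height_exp d alpha p) * twosided order_gap.
  by rewrite /riesz_cst -/M; ring.
apply: twosided_le.
- exact: order_gap_gt0.
- by rewrite !mulr_ge0 ?powR_ge0// ltW.
- move=> k; rewrite mule_ge0//; first by rewrite lee_fin mulr_ge0 ?powR_ge0.
  by apply: integral_ge0 => y _.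
move=> k; set Q := ccube _ _; set l := _ * 2 `^ k%:~R.
have l0 : 0 < l by exact: scale_gt0.
have lQ : side Q = l by [].
have Qx : (Q : set Rn) x.
  by apply: ccubeP => i; rewrite subrr normr0 divr_ge0// ltW.
set L := ln lam / ln 2; have lamE : lam = 2 `^ L by exact: pow2_log.
have lE : l = 2 `^ (L * (- (p / d)) + k%:~R).
  by rewrite /l lamE -powRrM -pow2D.
have dn : d != 0 by rewrite gt_eqF.
have pn : p != 0 by rewrite gt_eqF.
suff [c [c0 cM intc lc]] : exists c, [/\ 0 <= c, c <= M,
    (\int[mu]_(y in (Q : set Rn)) g y <=
     (c * (l `^ (n%:R - alpha) *
       (lam `^ height_exp d alpha p * 2 `^ (- (`|k|%:R * order_gap)))))%:E)%E
    & True].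
  apply: le_trans (lee_wpmul2l _ intc) _; first by rewrite lee_fin mulr_ge0 ?powR_ge0.
  rewrite -EFinM lee_fin -(opprB n%:R alpha) (powRN l).
  set u := l `^ (n%:R - alpha); set v := lam `^ height_exp d alpha p.
  set w := 2 `^ (- _); set z := 4 `^ (n%:R - alpha).
  have u0 : u != 0 by rewrite gt_eqF// powR_gt0.
  have -> : z / u * (c * (u * (v * w))) = z * c * v * w by field.
  by rewrite !ler_wpM2r ?powR_ge0// ler_wpM2l ?powR_ge0.
(* Small cubes: the average of order [lower_order] at [x] is at most
   [C0 * lam `^ height_exp]. *)
have [k0|k0] := leP 0 k; last first.
  exists C0; split => //; [exact: ltW|by rewrite le_max lexx|].
  have : ((l `^ (lower_order - n%:R))%:E * \int[mu]_(y in (Q : set Rn)) g y <=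
          (C0 * lam `^ height_exp d lower_order p)%:E)%E.
    by rewrite leNgt; apply/negP => h; apply: xsmall; exists Q.
  rewrite -lee_pdivlMl ?powR_gt0// => /le_trans; apply.
  rewrite -EFinM lee_fin mulrCA ler_pM2l// -powRN lE lamE -!powRrM -!pow2D ler_pow2.
  have -> : `|k|%:R = - k%:~R :> R by rewrite pmulrn ltz0_abs// mulrNz.
  rewrite /height_exp /lower_order le_eqVlt; apply/orP; left; apply/eqP; field.
  by rewrite dn.
(* Large cubes: the normalisation of [g] applies. *)
exists riesz_avg_cst; split => //.
- rewrite mulr_ge0// ltW// twosided_gt0// lt_min ltr01 subr_gt0.
  rewrite ltr_pdivlMr// mul1r -ltr_pdivrMr//; exact: le_lt_trans r_ge r_lt.
- by rewrite le_max lexx orbT.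
apply: le_trans (integral_cube_normalized Q d_gt0 d_le _ mg g0 ng) _.
  exact: le_lt_trans r_ge r_lt.
rewrite lee_fin -/riesz_avg_cst ler_wpM2l//.
  rewrite mulr_ge0// ltW// twosided_gt0// lt_min ltr01 subr_gt0.
  rewrite ltr_pdivlMr// mul1r -ltr_pdivrMr//; exact: le_lt_trans r_ge r_lt.
rewrite lQ lE lamE -!powRrM -!pow2D ler_pow2.
have -> : `|k|%:R = k%:~R :> R by rewrite pmulrn gez0_abs.
have kR : 0 <= k%:~R :> R by rewrite ler0z.
have : k%:~R * order_gap <= k%:~R * (d / p - alpha).
  by rewrite ler_wpM2l// ge_min lexx orbT.
rewrite -subr_ge0 => h; rewrite -subr_ge0; move: h; congr (_ <= _).
by rewrite /height_exp; field; rewrite dn pn.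
Qed.

End riesz.

(** * Discretisation of the Choquet integral *)

Section choquet_discretisation.
Context {R : realType}.
Implicit Types (phi : R -> \bar R) (a e : R).

Lemma nonincreasing_emeasurable (D : set R) phi : measurable D ->
  (forall s t, s <= t -> (phi t <= phi s)%E) -> measurable_fun D phi.
Proof.
move=> mD phi_dec; apply: measurable_funTS => _.
apply: (measurability _ (ErealGenOInfty.measurableE R)) => //.
move=> _ [_ [x ->] <-]; apply: measurableI => //.
apply: is_interval_measurable => s t /=.
rewrite !in_itv/= !andbT => xs xt u /andP[_ ut].
by rewrite in_itv/= andbT (lt_le_trans xt)// phi_dec.
Qed.

(** The geometric progression of ratio [2 `^ e] through [a]. *)
Definition tau a e (j : int) : R := a * 2 `^ (j%:~R * e).

Definition tau_itv a e j : set R := [set` `]tau a e j, tau a e (j + 1)]].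

Context (a e : R) (a0 : 0 < a) (e0 : 0 < e).

Lemma tau_gt0 j : 0 < tau a e j. Proof. by rewrite mulr_gt0// powR_gt0. Qed.

Lemma tauS j : tau a e (j + 1) = tau a e j * 2 `^ e.
Proof. by rewrite /tau intrD mulrDl mul1r pow2D mulrA. Qed.

Lemma ler_tau i j : (tau a e i <= tau a e j) = (i <= j).
Proof. by rewrite ler_pM2l// ler_pow2 ler_pM2r// ler_int. Qed.

Lemma ltr_tau i j : (tau a e i < tau a e j) = (i < j).
Proof. by rewrite !ltNge ler_tau. Qed.

Lemma tau_itv_cover t : 0 < t -> exists j, tau_itv a e j t.
Proof.
move=> t0; have [|j /andP[jt tj]] := @pow2_bracket_lt R ((t / a) `^ e^-1).
  by rewrite powR_gt0// divr_gt0.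
have ta0 : 0 <= t / a by rewrite divr_ge0// ltW.
have taE : t = a * ((t / a) `^ e^-1) `^ e.
  by rewrite -powRrM mulVf ?gt_eqF// powRr1// mulrC divfK// gt_eqF.
exists j; rewrite /tau_itv/= in_itv/= /tau !(powRrM 2) {1 2}taE.
rewrite ltr_pM2l// ler_pM2l// gt0_ltr_powR ?nnegrE ?powR_ge0//.
by rewrite ge0_ler_powR ?nnegrE ?powR_ge0// ltW.
Qed.

Lemma tau_itv_inj i j t : tau_itv a e i t -> tau_itv a e j t -> i = j.
Proof.
rewrite /tau_itv/= !in_itv/= => /andP[it ti] /andP[jt tj].
have := lt_le_trans it tj; have := lt_le_trans jt ti.
by rewrite !ltr_tau !ltzD1 => ji ij; apply/eqP; rewrite eq_le ij ji.
Qed.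

Lemma lebesgue_tau_itv j :
  lebesgue_measure (tau_itv a e j) = (tau a e j * (2 `^ e - 1))%:E.
Proof.
rewrite /tau_itv lebesgue_measure_itv/= lte_fin ltr_tau ltrDl ltr01.
by rewrite -EFinB tauS mulrBr mulr1.
Qed.

Lemma tau_itv_pos j : tau_itv a e j `&` [set` `]0, +oo[] = tau_itv a e j.
Proof.
apply/setIidl => t; rewrite /tau_itv/= !in_itv/= andbT => /andP[jt _].
exact: lt_trans (tau_gt0 j) jt.
Qed.

Lemma integral_tau_itv (c : \bar R) j : (0 <= c)%E ->
  (\int[lebesgue_measure]_(t in `]0%R, +oo[) (c * (\1_(tau_itv a e j) t)%:E) =
   (tau a e j * (2 `^ e - 1))%:E * c)%E.
Proof.
move=> c0; rewrite ge0_integralZl//.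
- rewrite integral_indic//; last exact: measurable_itv.
  by rewrite tau_itv_pos muleC; congr (_ * _)%E; exact: lebesgue_tau_itv.
- apply/measurable_EFinP; apply: measurable_indic; exact: measurable_itv.
Qed.

Context (phi : R -> \bar R) (phi_ge0 : forall t, (0 <= phi t)%E)
  (phi_dec : forall s t, s <= t -> (phi t <= phi s)%E).

Let measurable_step (c : \bar R) j (D : set R) :
  measurable_fun D (fun t => (c * (\1_(tau_itv a e j) t)%:E)%E).
Proof.
apply: measurable_funeM; apply/measurable_EFinP; apply: measurable_indic.
exact: measurable_itv.
Qed.

Lemma integral_le_dyadic_sum :
  (\int[lebesgue_measure]_(t in `]0%R, +oo[) phi t <=
   \esum_(j in [set: int]) ((tau a e j * (2 `^ e - 1))%:E * phi (tau a e j)))%E.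
Proof.
under eq_esum do rewrite -integral_tau_itv//.
have T0 j t : (0 <= phi (tau a e j) * (\1_(tau_itv a e j) t)%:E)%E.
  by rewrite mule_ge0.
apply: le_integral_esum; [exact: measurable_itv|exact: phi_ge0| |exact: T0| |].
- by apply: nonincreasing_emeasurable => //; exact: measurable_itv.
- by move=> j; exact: measurable_step.
- move=> t; rewrite /= in_itv/= andbT => /tau_itv_cover[j tj].
  apply: le_trans (esum_term j (T0^~ t)); rewrite indicE mem_set// mule1.
  by apply: phi_dec; move: tj; rewrite /tau_itv/= in_itv/= => /andP[/ltW].
Qed.

Lemma dyadic_sum_le_integral :
  (\esum_(j in [set: int]) ((tau a e j * (2 `^ e - 1))%:E * phi (tau a e (j + 1))) <=
   \int[lebesgue_measure]_(t in `]0%R, +oo[) phi t)%E.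
Proof.
under eq_esum do rewrite -integral_tau_itv//.
have T0 j t : (0 <= phi (tau a e (j + 1)) * (\1_(tau_itv a e j) t)%:E)%E.
  by rewrite mule_ge0.
rewrite -integral_esum//; last by move=> j; exact: measurable_step.
apply: ge0_le_integral => //.
- by move=> t _; apply: esum_ge0.
- by apply: measurable_esum => // j; exact: measurable_step.
- by apply: nonincreasing_emeasurable => //; exact: measurable_itv.
move=> t _; apply: esum_le => S uS.
have [[j jS tj]|noj] := pselect (exists2 j, j \in S & tau_itv a e j t).
  rewrite (bigD1_seq j)//= big1 ?adde0.
    rewrite indicE mem_set// mule1; apply: phi_dec.
    by move: tj; rewrite /tau_itv/= in_itv/= => /andP[].
  move=> i /eqP ij; rewrite indicE memNset ?mule0// => ti.
  by apply: ij; exact: tau_itv_inj ti tj.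
rewrite big1_seq// => j /andP[_ jS]; rewrite indicE memNset ?mule0// => tj.
by apply: noj; exists j.
Qed.

Lemma chebyshev_nonincreasing (T : R) : 0 < T ->
  (T%:E * phi T <= \int[lebesgue_measure]_(t in `]0%R, +oo[) phi t)%E.
Proof.
move=> T0; pose J : set R := [set` `]0, T]].
have mT : measurable J by exact: measurable_itv.
have -> : (T%:E * phi T = \int[lebesgue_measure]_(t in `]0%R, +oo[)
    (phi T * (\1_J t)%:E))%E.
  rewrite ge0_integralZl//.
    rewrite integral_indic// muleC; congr (_ * _)%E.
    rewrite setIidl; last by move=> t /=; rewrite !in_itv/= andbT => /andP[].
    have JE : lebesgue_measure J = T%:E.
      by rewrite /J lebesgue_measure_itv/= lte_fin T0 oppr0 adde0.
    exact: esym JE.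
  by apply/measurable_EFinP; exact: measurable_indic.
apply: ge0_le_integral => //.
- by move=> t _; rewrite mule_ge0.
- by apply: measurable_funeM; apply/measurable_EFinP; exact: measurable_indic.
- by apply: nonincreasing_emeasurable => //; exact: measurable_itv.
move=> t _; rewrite indicE; case: (boolP (t \in _)) => [/set_mem|_].
  by rewrite /J/= in_itv/= mule1 => /andP[_ /phi_dec].
by rewrite mule0.
Qed.

End choquet_discretisation.

(** * From estimates on levels to norm inequalities *)

Section norms.
Context {R : realType} {n : nat}.
Local Notation Rn := (euclidean R n).
Implicit Types (f F g : Rn -> \bar R) (d p q A : R).

Lemma lt_poweR p (s : R) (y : \bar R) : 0 < p -> 0 <= s -> (0 <= y)%E ->
  ((s `^ p)%:E < y `^ p)%E = (s%:E < y)%E.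
Proof.
move=> p0 s0; case: y => [y| |]//.
  rewrite lee_fin => y0; rewrite poweR_EFin !lte_fin.
  apply/idP/idP => [|sy]; last by apply: gt0_ltr_powR; rewrite ?nnegrE.
  rewrite !ltNge; apply: contra => ys.
  by apply: ge0_ler_powR; rewrite ?nnegrE// ltW.
by move=> _; rewrite poweRyr ?gt_eqF// !ltry.
Qed.

(** An estimate proved for every real number above [Y] holds for [Y] itself; this
    spares the discussion of functions of norm zero. *)
Lemma le_of_upper_bounds (C : R) (X Y : \bar R) : 0 < C -> (0 <= Y)%E ->
  (Y < +oo)%E -> (forall A, 0 < A -> (Y <= A%:E)%E -> (X <= (C * A)%:E)%E) ->
  (X <= C%:E * Y)%E.
Proof.
move=> C0; case: Y => [y| |]//; rewrite lee_fin => y0 _ XC.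
apply/lee_addgt0Pr => e e0.
have yA : 0 < y + e / C by rewrite ltr_wpDl// divr_gt0.
apply: le_trans (XC _ yA _) _; first by rewrite lee_fin lerDl divr_ge0// ltW.
by rewrite -EFinM -EFinD lee_fin mulrDr mulrCA divff ?gt_eqF// mulr1.
Qed.

Lemma wLnorm_ge0 d p f : (0 <= wLnorm_hcontent d p f)%E.
Proof.
apply: le_trans (ereal_sup_ubound _); last first.
  by exists 1; rewrite /= ?in_itv/= ?andbT ?ltr01.
by rewrite mule_ge0 ?poweR_ge0// lee_fin.
Qed.

(** Rescaling by an upper bound [A] of the norm of [f] makes it normalised. *)
Definition rescale A f x : \bar R := (`|f x| * (A^-1)%:E)%E.

Lemma rescale_ge0 A f x : 0 < A -> (0 <= rescale A f x)%E.
Proof. by move=> A0; rewrite mule_ge0// lee_fin invr_ge0 ltW. Qed.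

Lemma measurable_rescale A f : measurable_fun setT f ->
  measurable_fun setT (rescale A f).
Proof.
move=> mf; rewrite (_ : rescale A f = fun x => ((A^-1)%:E * `|f x|)%E); last first.
  by apply/funext => x; rewrite /rescale muleC.
by apply: measurable_funeM; apply: measurableT_comp.
Qed.

Lemma level_rescale A f t : 0 < A ->
  level (rescale A f) t = [set x | (A * t)%:E < `|f x|]%E.
Proof.
move=> A0; apply/seteqP; split => x; rewrite /level/= /rescale lte_pdivlMr//.
  by rewrite -EFinM mulrC.
by rewrite -EFinM mulrC.
Qed.

Lemma wLnorm_normalized d p A f : 0 < p -> 0 < A ->
  (wLnorm_hcontent d p f <= A%:E)%E -> normalized d p (rescale A f).
Proof.
move=> p0 A0 fA t t0; rewrite level_rescale//; set H := hcontent _ _.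
have At : 0 < A * t by rewrite mulr_gt0.
have : ((A * t)%:E * H `^ p^-1 <= A%:E)%E.
  apply: le_trans fA; apply: ereal_sup_ubound; exists (A * t) => //.
  by rewrite /= in_itv/= andbT.
rewrite -lee_pdivlMl// -EFinM invfM mulrAC mulVf ?gt_eqF// mul1r => HA.
have -> : H = ((H `^ p^-1) `^ p)%E.
  by rewrite -poweRrM mulVf ?gt_eqF// poweRe1// hcontent_ge0.
apply: le_trans (_ : _ <= (t^-1)%:E `^ p)%E _.
  apply: gt0_ler_poweR => //; first exact: ltW.
  - by rewrite in_itv/= poweR_ge0 leey.
  - by rewrite in_itv/= lee_fin invr_ge0 (ltW t0) leey.
by rewrite poweR_EFin -powR_inv1 ?(ltW t0)// -powRrM mulN1r.
Qed.

(** Every height is of the form [A * (C0 * lam `^ gamma)], and the hypothesis is the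
    weak type inequality at this height. *)
Lemma wLnorm_le delta q F (A C0 C gamma e : R) :
  0 < q -> 0 < A -> 0 < C0 -> 0 < gamma -> 0 <= C -> gamma * q = e ->
  (forall lam, 0 < lam ->
    (hcontent delta [set x | (A * (C0 * lam `^ gamma))%:E < `|F x|]%E <=
     (C * lam `^ (- e))%:E)%E) ->
  (wLnorm_hcontent delta q F <= (C0 * C `^ q^-1 * A)%:E)%E.
Proof.
move=> q0 A0 C00 g0 C1 ge FC; apply: ge_ereal_sup => _ [t + <-].
rewrite /= in_itv/= andbT => t0.
pose lam := (t / (A * C0)) `^ gamma^-1.
have AC : 0 < A * C0 by rewrite mulr_gt0.
have lam0 : 0 < lam by rewrite powR_gt0// divr_gt0.
have lamE : lam `^ gamma = t / (A * C0).
  by rewrite /lam -powRrM mulVf ?gt_eqF// powRr1// divr_ge0// ltW.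
have tE : A * (C0 * lam `^ gamma) = t.
  by rewrite lamE mulrA mulrC divfK// gt_eqF.
have := FC _ lam0; rewrite tE => Ht.
apply: le_trans (_ : _ <= t%:E * (C * lam `^ (- e))%:E `^ q^-1)%E _.
  apply: lee_wpmul2l; first by rewrite lee_fin ltW.
  apply: gt0_ler_poweR => //; first by rewrite invr_ge0 ltW.
  - by rewrite in_itv/= hcontent_ge0 leey.
  - by rewrite in_itv/= lee_fin mulr_ge0 ?powR_ge0 ?leey.
rewrite poweR_EFin -EFinM lee_fin powRM ?powR_ge0// -powRrM.
have -> : - e * q^-1 = - gamma by rewrite -ge mulNr mulfK// gt_eqF.
rewrite powRN lamE -tE lamE le_eqVlt; apply/orP; left; apply/eqP.
by field; rewrite !gt_eqF.
Qed.

Lemma hcontent_level_dec d F (s t : R) : s <= t ->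
  (hcontent d [set x | t%:E < F x]%E <= hcontent d [set x | s%:E < F x]%E)%E.
Proof.
move=> st; apply: le_hcontent => x /=; apply: le_lt_trans.
by rewrite lee_fin.
Qed.

Lemma exchange_esum (I J : choiceType) (a : I -> J -> \bar R) :
  (forall i j, 0 <= a i j)%E ->
  (\esum_(i in [set: I]) \esum_(j in [set: J]) a i j =
   \esum_(j in [set: J]) \esum_(i in [set: I]) a i j)%E.
Proof.
move=> a0; rewrite !esum_esum//.
rewrite (reindex_esum ([set: J] `*`` (fun=> [set: I])) _ (fun k => (k.2, k.1)))//.
split => //.
- by move=> [i j] [i' j'] _ _ [-> ->].
- by move=> [i j] _; exists (j, i).
Qed.

(** Once the summations are interchanged, the shift of the scale by [k] leaves the
    sum over [int] unchanged. *)
Lemma sum_level_sum d p kappa g (K : R) : 0 < kappa -> 0 <= K ->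
  (\esum_(j in [set: int]) (((2 `^ j%:~R) `^ p)%:E *
     hcontent d (level g (2 `^ j%:~R))) <= K%:E)%E ->
  (\esum_(j in [set: int]) level_sum d p kappa g (2 `^ j%:~R) <=
   (twosided kappa * K)%:E)%E.
Proof.
move=> kappa0 K0; set b := fun j : int => _ => bK.
have b0 j : (0 <= b j)%E by rewrite mule_ge0 ?hcontent_ge0// lee_fin powR_ge0.
rewrite exchange_esum; last first.
  by move=> *; rewrite mule_ge0 ?hcontent_ge0// lee_fin mulr_ge0 ?powR_ge0.
apply: (@le_trans _ _ (\esum_(k in [set: nat])
    ((2 `^ (- (k%:R * kappa)))%:E * \esum_(j in [set: int]) b j))%E).
  apply: le_esum => k _.
  rewrite (reindex_esum [set: int] [set: int] (fun j : int => j + k%:Z)); last first.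
    split => //; first by move=> i j _ _ /addIr.
    by move=> i _; exists (i - k%:Z) => //=; rewrite subrK.
  rewrite -(@esumZl R int (2 `^ (- (k%:R * kappa))) (fun i => b (i + k%:Z))).
  - apply: le_esum => j _; rewrite /b intrD pow2D -pmulrn mulrC EFinM muleA.
    by rewrite lexx.
  - exact: powR_ge0.
  - by move=> j; exact: b0.
apply: (@le_trans _ _ (\esum_(k in [set: nat])
    (K%:E * (2 `^ (- (k%:R * kappa)))%:E))%E).
  by apply: le_esum => k _; rewrite muleC; apply: lee_wpmul2r.
rewrite esumZl// mulrC EFinM; apply: lee_wpmul2l => //.
rewrite -twosidedE//; apply: (@esum_sub R int nat _ Posz) => //.
by move=> i j _ _ [].
Qed.

Let phi d p F (t : R) : \bar R :=
  hcontent d [set x | t%:E < `|F x| `^ p]%E.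

Let phi_ge0 d p F t : (0 <= phi d p F t)%E. Proof. exact: hcontent_ge0. Qed.

Let phi_dec d p F s t : s <= t -> (phi d p F t <= phi d p F s)%E.
Proof. exact: hcontent_level_dec. Qed.

Let phi_pow d p F s : 0 < p -> 0 <= s ->
  phi d p F (s `^ p) = hcontent d [set x | s%:E < `|F x|]%E.
Proof.
move=> p0 s0; rewrite /phi; congr (hcontent _ _).
by apply/seteqP; split => x /=; rewrite lt_poweR.
Qed.

Let choquet_le d p A F : 0 < p -> 0 < A ->
  (Lnorm_hcontent d p F <= A%:E)%E ->
  (\int[lebesgue_measure]_(t in `]0%R, +oo[) phi d p F t <= (A `^ p)%:E)%E.
Proof.
move=> p0 A0; rewrite /Lnorm_hcontent /choquet -/(phi d p F) => FA.
set J := (\int[_]_(_ in _) _)%E in FA *.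
have J0 : (0 <= J)%E by apply: integral_ge0 => t _; exact: hcontent_ge0.
have -> : J = ((J `^ p^-1) `^ p)%E.
  by rewrite -poweRrM mulVf ?gt_eqF// poweRe1.
rewrite -poweR_EFin; apply: gt0_ler_poweR => //; first exact: ltW.
- by rewrite in_itv/= poweR_ge0 leey.
- by rewrite in_itv/= lee_fin (ltW A0) leey.
Qed.

Lemma Lnorm_normalized d p A f : 0 < p -> 0 < A ->
  (Lnorm_hcontent d p f <= A%:E)%E -> normalized d p (rescale A f).
Proof.
move=> p0 A0 /(choquet_le p0 A0) fA t t0; rewrite level_rescale//.
have At : 0 < A * t by rewrite mulr_gt0.
have := chebyshev_nonincreasing (phi_ge0 d p f) (phi_dec d p f) (powR_gt0 p At).
move=> /le_trans/(_ fA); rewrite phi_pow ?(ltW At)//.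
rewrite -lee_pdivlMl ?powR_gt0// => /le_trans; apply.
rewrite -EFinM lee_fin powRM ?(ltW A0) ?(ltW t0)// powRN.
by rewrite invfM mulrAC mulVf ?mul1r// gt_eqF// powR_gt0.
Qed.

(** The Choquet integral of [|f| ^ p] is discretised along the heights
    [A ^ p * 2 ^ (j * p)], which correspond to the levels [2 ^ j] of the rescaled
    function. *)
Lemma Lnorm_levels d p A f : 0 < p -> 0 < A ->
  (Lnorm_hcontent d p f <= A%:E)%E ->
  (\esum_(j in [set: int]) (((2 `^ j%:~R) `^ p)%:E *
     hcontent d (level (rescale A f) (2 `^ j%:~R))) <=
   (2 `^ p / (2 `^ p - 1))%:E)%E.
Proof.
move=> p0 A0 /(choquet_le p0 A0) fA.
have Ap : 0 < A `^ p by rewrite powR_gt0.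
have p1 : 0 < (2 : R) `^ p - 1 by rewrite subr_gt0 -[ltLHS](powRr0 2) ltr_pow2.
rewrite (reindex_esum [set: int] [set: int] (fun j : int => j + 1)); last first.
  split => //; first by move=> i j _ _ /addIr.
  by move=> i _; exists (i - 1) => //=; rewrite subrK.
have := dyadic_sum_le_integral Ap p0 (phi_ge0 d p f) (phi_dec d p f).
move=> /le_trans/(_ fA) h.
pose c := 2 `^ p / (2 `^ p - 1) / A `^ p.
have c0 : 0 < c by rewrite !divr_gt0// powR_gt0.
apply: le_trans (_ : _ <= c%:E * (A `^ p)%:E)%E _; last first.
  by rewrite -EFinM lee_fin /c divfK// gt_eqF.
apply: le_trans (lee_wpmul2l _ h); last by rewrite lee_fin ltW.
rewrite -esumZl ?(ltW c0)//; last first.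
  move=> j; rewrite mule_ge0 ?phi_ge0// lee_fin mulr_ge0 ?(ltW p1)//.
  exact/ltW/tau_gt0.
apply: le_esum => j _; rewrite level_rescale// muleA -EFinM.
have -> : tau (A `^ p) p (j + 1) = (A * 2 `^ (j + 1)%:~R) `^ p.
  by rewrite /tau powRM ?powR_ge0 ?(ltW A0)// -powRrM.
rewrite phi_pow ?mulr_ge0 ?powR_ge0 ?(ltW A0)//.
rewrite le_eqVlt; apply/orP; left; apply/eqP; congr ((_)%:E * _)%E.
rewrite /c /tau -powRrM intrD mulrDl pow2D mul1r.
by field; rewrite !gt_eqF.
Qed.

(** The Choquet integral of [|F| ^ q] is discretised along the heights given by
    [lam = 2 ^ j], at which the factors [lam `^ (- e)] are exactly compensated by
    the lengths of the intervals of heights. *)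
Lemma Lnorm_le delta q F (A C0 C gamma e S : R) (s : R -> \bar R) :
  0 < q -> 0 < A -> 0 < C0 -> 0 <= C -> 0 <= S -> 0 < e -> gamma * q = e ->
  (forall lam, 0 <= s lam)%E ->
  (forall lam, 0 < lam ->
    (hcontent delta [set x | (A * (C0 * lam `^ gamma))%:E < `|F x|]%E <=
     (C * lam `^ (- e))%:E * s lam)%E) ->
  (\esum_(j in [set: int]) s (2 `^ j%:~R)%R <= S%:E)%E ->
  (Lnorm_hcontent delta q F <=
   (C0 * ((2 `^ e - 1) * C * S) `^ q^-1 * A)%:E)%E.
Proof.
move=> q0 A0 C00 C1 S0 e0 ge s0 FC sS.
have AC : 0 < A * C0 by rewrite mulr_gt0.
have ACq : 0 < (A * C0) `^ q by rewrite powR_gt0.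
have e1 : 0 < (2 : R) `^ e - 1 by rewrite subr_gt0 -[ltLHS](powRr0 2) ltr_pow2.
have D0 : 0 <= (2 `^ e - 1) * C * S by rewrite !mulr_ge0// ltW.
have -> : C0 * ((2 `^ e - 1) * C * S) `^ q^-1 * A =
    ((A * C0) `^ q * ((2 `^ e - 1) * C * S)) `^ q^-1.
  rewrite [RHS]powRM ?powR_ge0// -(powRrM _ q) divff ?gt_eqF// powRr1 ?(ltW AC)//.
  by ring.
rewrite -poweR_EFin; apply: gt0_ler_poweR.
- by rewrite invr_ge0 ltW.
- by rewrite in_itv/= leey andbT; apply: integral_ge0 => t _; exact: hcontent_ge0.
- by rewrite in_itv/= leey andbT lee_fin mulr_ge0// ltW.
rewrite /choquet -/(phi delta q F).
apply: le_trans (integral_le_dyadic_sum ACq e0 (phi_ge0 delta q F) (phi_dec delta q F)) _.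
pose c := (A * C0) `^ q * ((2 `^ e - 1) * C).
have c0 : 0 <= c by rewrite mulr_ge0 ?(ltW ACq)// mulr_ge0// ltW.
rewrite [X in (_ <= X%:E)%E](_ : _ = c * S); last by rewrite /c; ring.
rewrite EFinM; apply: le_trans (lee_wpmul2l _ sS); last by rewrite lee_fin.
rewrite -esumZl//.
apply: le_esum => j _.
have tauE : tau ((A * C0) `^ q) e j = (A * (C0 * (2 `^ j%:~R) `^ gamma)) `^ q.
  rewrite mulrA /tau [RHS]powRM ?powR_ge0 ?(ltW AC)//.
  by rewrite -!powRrM ge.
rewrite [in X in phi _ _ _ X]tauE phi_pow//; last first.
  by rewrite mulr_ge0 ?(ltW A0)// mulr_ge0 ?powR_ge0 ?(ltW C00).
apply: le_trans (lee_wpmul2l _ (FC _ (pow2_gt0 _))) _.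
  by rewrite lee_fin mulr_ge0 ?(ltW e1)//; exact/ltW/tau_gt0.
rewrite muleA -EFinM le_eqVlt; apply/orP; left; apply/eqP; congr ((_)%:E * _)%E.
rewrite /c /tau -powRrM mulrN powRN.
by field; rewrite gt_eqF// powR_gt0.
Qed.

End norms.

(** * Boundedness of the fractional operators *)

Section operators.
Context {R : realType} {n : nat}.
Local Notation Rn := (euclidean R n).
Local Notation mu := (@lebesgue R n).
Implicit Types (f g : Rn -> \bar R) (alpha A : R).

Lemma integral_rescale (Q : set Rn) A f : 0 < A -> measurable Q ->
  measurable_fun setT f ->
  (\int[mu]_(y in Q) rescale A f y = (A^-1)%:E * \int[mu]_(y in Q) `|f y|)%E.
Proof.
move=> A0 mQ mf; under eq_integral do rewrite /rescale muleC.
apply: ge0_integralZl.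
- exact: mQ.
- by apply: measurable_funTS; apply: measurableT_comp.
- by move=> y _; exact: abse_ge0.
- by rewrite lee_fin invr_ge0 ltW.
Qed.

Lemma fmaximal_ge0 alpha f x : (0 <= fmaximal alpha f x)%E.
Proof.
apply: le_trans (ereal_sup_ubound _); last first.
  by exists (Cube x (ltr01 : 0 < 1 :> R)).
rewrite !mule_ge0//; first by rewrite lee_fin powR_ge0.
by apply: integral_ge0 => y _; exact: abse_ge0.
Qed.

Lemma fmaximal_bigavg alpha A f t : 0 < A -> 0 < t -> measurable_fun setT f ->
  [set x | (A * t)%:E < `|fmaximal alpha f x|]%E `<=`
  bigavg alpha (rescale A f) t.
Proof.
move=> A0 t0 mf x /=; rewrite gee0_abs ?fmaximal_ge0// => /ereal_sup_gt[_ [Q _ <-]].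
have [mQ _] := lebesgue_cube Q.
have [Qx|Qx] := pselect ((Q : set Rn) x); last first.
  rewrite indicE memNset// !mul0e lte_fin => /ltW.
  by rewrite leNgt mulr_gt0.
rewrite indicE mem_set// mul1e => h; exists Q => //.
rewrite integral_rescale// muleCA lte_pdivlMl//.
Qed.

Lemma fintegral_le alpha A f x : 0 < A -> measurable_fun setT f ->
  (`|fintegral alpha f x| <=
   A%:E * \int[mu]_y (rescale A f y * (kernel alpha x y)%:E))%E.
Proof.
move=> A0 mf; have mk := measurable_kernel (n := n) alpha x.
have mK : measurable_fun setT (fun y => (kernel alpha x y)%:E : \bar R).
  exact/measurable_EFinP.
have mgK : measurable_fun setT (fun y => rescale A f y * (kernel alpha x y)%:E)%E.
  by apply: emeasurable_funM; [exact: measurable_rescale|exact: mK].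
have <- : (\int[mu]_y (A%:E * (rescale A f y * (kernel alpha x y)%:E)) =
    A%:E * \int[mu]_y (rescale A f y * (kernel alpha x y)%:E))%E.
  apply: ge0_integralZl; [exact: measurableT|exact: mgK| |].
  - by move=> y _; rewrite mule_ge0 ?rescale_ge0// lee_fin kernel_ge0.
  - by rewrite lee_fin ltW.
apply: le_trans (le_abse_integral _ measurableT (emeasurable_funM mf mK)) _.
rewrite le_eqVlt; apply/orP; left; apply/eqP; apply: eq_integral => y _.
rewrite abseM [X in (_ * X)%E = _]gee0_abs ?lee_fin ?kernel_ge0//.
rewrite /rescale muleA (muleC A%:E) -(muleA `|f y|)%E -EFinM mulVf ?gt_eqF//.
by rewrite mule1.
Qed.

Context (d alpha r p q : R).
Context (d_gt0 : 0 < d) (d_le : d <= n%:R) (alpha_ge0 : 0 <= alpha)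
  (alpha_lt : alpha < n%:R)  (r_ge : d / n%:R <= r) (r_lt : r < p) (p_lt : alpha * p < d)
  (q_gt0 : 0 < q) (scaling : (d - alpha * r) / q = (d - alpha * p) / p).

Let n_gt0 : 0 < n%:R :> R. Proof. exact: lt_le_trans d_le. Qed.
Let r_gt0 : 0 < r. Proof. by apply: lt_le_trans r_ge; rewrite divr_gt0. Qed.
Let p_gt0 : 0 < p. Proof. exact: lt_trans r_lt. Qed.

Let height_exp_q : height_exp d alpha p * q = decay_exp d alpha r p.
Proof.
have e : (d - alpha * r) * p = (d - alpha * p) * q.
  have := congr1 (fun u => u * (p * q)) scaling.
  have -> : (d - alpha * r) / q * (p * q) = (d - alpha * r) * p.
    by field; rewrite gt_eqF.
  have -> // : (d - alpha * p) / p * (p * q) = (d - alpha * p) * q.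
  by field; rewrite gt_eqF.
rewrite /height_exp /decay_exp /target_dim [p * (_ - _)]mulrC e; field; exact: lt0r_neq0.
Qed.

Definition packing_cst := 3 `^ target_dim d alpha r * (2 * 2 `^ d * 2 ^+ n).

Let packing_cst_gt0 : 0 < packing_cst.
Proof. by rewrite !mulr_gt0 ?powR_gt0 ?exprn_gt0. Qed.

(** The estimate shared by both operators, from which the weak and the strong type
    inequalities follow: it bounds the content of a superlevel set by all the levels
    of [f] above the corresponding height, with geometric weights. *)
Definition controlled (T : (Rn -> \bar R) -> Rn -> \bar R) (C0 kappa : R) :=
  forall f A lam, measurable_fun setT f -> 0 < A ->
  normalized d p (rescale A f) -> 0 < lam ->
  (hcontent (d - alpha * r)
     [set x | (A * (C0 * lam `^ height_exp d alpha p))%:E < `|T f x|]%E <=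
   (packing_cst * lam `^ (- decay_exp d alpha r p))%:E *
    level_sum d p kappa (rescale A f) lam)%E.

Lemma fmaximal_controlled : controlled (fmaximal alpha)
  (bigavg_cst (n := n) d alpha r p) (sum_decay d alpha r p).
Proof.
move=> f A lam mf A0 nf lam0.
have C0 : 0 < bigavg_cst (n := n) d alpha r p by exact: bigavg_cst_gt0.
have h := hcontent_bigavg d_gt0 d_le alpha_ge0 alpha_lt r_ge r_lt p_lt
  (measurable_rescale A mf) (fun x => rescale_ge0 f x A0) nf lam0.
apply: le_trans h.
apply: le_hcontent; apply: fmaximal_bigavg => //.
by rewrite mulr_gt0// powR_gt0.
Qed.

(** The pair [(lower_order, lower_index)] has the same [target_dim], hence the same
    [decay_exp], as [(alpha, r)]; the pointwise estimate transfers the height. *)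
Lemma fintegral_controlled : 0 < alpha -> controlled (fintegral alpha)
  (riesz_cst (n := n) d alpha r p)
  (sum_decay d (lower_order d alpha r p) (lower_index d alpha r p) p).
Proof.
move=> alpha0 f A lam mf A0 nf lam0.
have b0 := lower_order_gt0 d_gt0 d_le alpha0 r_ge r_lt.
have bl := lower_order_lt d_gt0 d_le alpha0 r_ge r_lt p_lt.
have bn : lower_order d alpha r p < n%:R by exact: lt_trans alpha_lt.
have rho1 := lower_index_ge d_gt0 d_le alpha0 r_ge r_lt p_lt.
have rho2 := lower_index_lt d_gt0 d_le alpha0 r_ge r_lt.
have bp := lower_order_p_lt d_gt0 d_le alpha0 r_ge r_lt p_lt.
have mg := measurable_rescale A mf.
have g0 x := rescale_ge0 f x A0.
have := hcontent_bigavg d_gt0 d_le (ltW b0) bn rho1 rho2 bp mg g0 nf lam0.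
rewrite /decay_exp (target_dim_lower d_gt0 d_le alpha0 r_ge r_lt).
rewrite -/(decay_exp d alpha r p) -/packing_cst.
apply: le_trans; apply: le_hcontent => x /= h.
apply: riesz_pointwise => //.
have := lt_le_trans h (fintegral_le alpha x A0 mf).
by rewrite -lte_pdivrMl// -EFinM mulKf// gt_eqF.
Qed.

Lemma controlled_weak T C0 kappa : 0 < C0 -> 0 < kappa -> controlled T C0 kappa ->
  exists2 C : R, 0 < C & forall f : Rn -> \bar R,
    measurable_fun setT f -> (wLnorm_hcontent d p f < +oo)%E ->
    (wLnorm_hcontent (d - alpha * r) q (T f) <= C%:E * wLnorm_hcontent d p f)%E.
Proof.
move=> C00 kappa0 TC; set K := packing_cst * twosided kappa.
have K0 : 0 < K by rewrite mulr_gt0// twosided_gt0.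
exists (C0 * K `^ q^-1); first by rewrite mulr_gt0// powR_gt0.
move=> f mf foo; apply: le_of_upper_bounds foo _; first by rewrite mulr_gt0// powR_gt0.
  exact: wLnorm_ge0.
move=> A A0 fA; have nf := wLnorm_normalized p_gt0 A0 fA.
apply: (wLnorm_le q_gt0 A0 C00 _ _ height_exp_q) => //.
- exact: height_exp_gt0.
- exact: ltW.
move=> lam lam0; apply: le_trans (TC f A lam mf A0 nf lam0) _.
rewrite /K [X in (_ <= X%:E)%E]mulrAC [leRHS]EFinM; apply: lee_wpmul2l.
  by rewrite lee_fin mulr_ge0 ?powR_ge0// ltW.
exact: level_sum_le.
Qed.

Lemma controlled_strong T C0 kappa : 0 < C0 -> 0 < kappa -> controlled T C0 kappa ->
  exists2 C : R, 0 < C & forall f : Rn -> \bar R,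
    measurable_fun setT f -> (Lnorm_hcontent d p f < +oo)%E ->
    (Lnorm_hcontent (d - alpha * r) q (T f) <= C%:E * Lnorm_hcontent d p f)%E.
Proof.
move=> C00 kappa0 TC.
set e := decay_exp d alpha r p; set S := twosided kappa * (2 `^ p / (2 `^ p - 1)).
have e0 : 0 < e by exact: (decay_exp_gt0 d_gt0 d_le alpha_ge0 r_ge r_lt p_lt).
have p1 : 0 < (2 : R) `^ p - 1 by rewrite subr_gt0 -[ltLHS](powRr0 2) ltr_pow2.
have e1 : 0 < (2 : R) `^ e - 1 by rewrite subr_gt0 -[ltLHS](powRr0 2) ltr_pow2.
have K0 : 0 < 2 `^ p / (2 `^ p - 1) :> R by rewrite divr_gt0// powR_gt0.
have S0 : 0 < S by rewrite mulr_gt0// twosided_gt0.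
have C1 : 0 < C0 * ((2 `^ e - 1) * packing_cst * S) `^ q^-1.
  apply: mulr_gt0 => //; apply: powR_gt0; apply: mulr_gt0 => //.
  exact: mulr_gt0.
exists (C0 * ((2 `^ e - 1) * packing_cst * S) `^ q^-1) => // f mf foo.
apply: le_of_upper_bounds foo _ => //; first exact: poweR_ge0.
move=> A A0 fA; have nf := Lnorm_normalized p_gt0 A0 fA.
apply: (Lnorm_le (s := level_sum d p kappa (rescale A f)) q_gt0 A0 C00 _ _ e0
  height_exp_q).
- exact: ltW.
- exact: ltW.
- move=> lam; apply: esum_ge0 => k _.
  by rewrite mule_ge0 ?hcontent_ge0// lee_fin mulr_ge0 ?powR_ge0.
- by move=> lam lam0; exact: TC.
- apply: sum_level_sum => //; first exact: ltW.
  exact: Lnorm_levels.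
Qed.

End operators.

Theorem theorem1p1 (R : realType) (n : nat) :
  (forall d alpha r p q : R,
     0 < d -> d <= n%:R -> 0 <= alpha -> alpha < n%:R ->
     d / n%:R <= r -> r < p -> (p%:E < critical_exponent d alpha)%E ->
     0 < q -> (d - alpha * r) / q = (d - alpha * p) / p ->
     exists2 C : R, 0 < C & forall f : euclidean R n -> \bar R,
       measurable_fun setT f ->
       (wLnorm_hcontent d p f < +oo)%E ->
       (wLnorm_hcontent (d - alpha * r) q (fmaximal alpha f) <=
          C%:E * wLnorm_hcontent d p f)%E) /\
  (forall d alpha r p q : R,
     0 < d -> d < n%:R -> 0 < alpha -> alpha < n%:R ->
     d / n%:R < r -> r < p -> (p%:E < critical_exponent d alpha)%E ->
     0 < q -> (d - alpha * r) / q = (d - alpha * p) / p ->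
     exists2 C : R, 0 < C & forall f : euclidean R n -> \bar R,
       measurable_fun setT f ->
       (wLnorm_hcontent d p f < +oo)%E ->
       (wLnorm_hcontent (d - alpha * r) q (fintegral alpha f) <=
          C%:E * wLnorm_hcontent d p f)%E) /\
  (forall d alpha r p q : R,
     0 < d -> d < n%:R -> 0 < alpha -> alpha < n%:R ->
     d / n%:R < r -> r < p -> (p%:E < critical_exponent d alpha)%E ->
     0 < q -> (d - alpha * r) / q = (d - alpha * p) / p ->
     exists2 C : R, 0 < C & forall f : euclidean R n -> \bar R,
       measurable_fun setT f ->
       (Lnorm_hcontent d p f < +oo)%E ->
       (Lnorm_hcontent (d - alpha * r) q (fintegral alpha f) <=
          C%:E * Lnorm_hcontent d p f)%E).

Proof.
have crit (d alpha p : R) : 0 < d -> 0 <= alpha ->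
    (p%:E < critical_exponent d alpha)%E -> alpha * p < d.
  rewrite /critical_exponent le_eqVlt => d0 /predU1P[<- _|alpha0].
    by rewrite mul0r.
  by rewrite gt_eqF// lte_fin ltr_pdivlMr// mulrC.
(* The hypotheses common to the second and the third part. *)
have strict (d alpha r p : R) : 0 < d -> d < n%:R -> 0 < alpha ->
    alpha < n%:R -> d / n%:R < r -> r < p ->
    (p%:E < critical_exponent d alpha)%E ->
    [/\ 0 < riesz_cst (n := n) d alpha r p,
        0 < sum_decay d (lower_order d alpha r p) (lower_index d alpha r p) p &
        controlled (n := n) d alpha r p (fintegral alpha)
          (riesz_cst (n := n) d alpha r p)
          (sum_decay d (lower_order d alpha r p) (lower_index d alpha r p) p)].
  move=> d0 /ltW dn al0 aln /ltW rd rp /(crit _ _ _ d0 (ltW al0)) ap.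
  split; [exact: riesz_cst_gt0| |exact: fintegral_controlled].
  have rho1 := lower_index_ge d0 dn al0 rd rp ap.
  have rho2 := lower_index_lt d0 dn al0 rd rp.
  exact: (@sum_decay_gt0 R n d (lower_order d alpha r p) _ p d0 dn rho1 rho2).
split; [|split] => d alpha r p q d0 dn al0 aln rd rp pc q0 sc.
- have ap := crit _ _ _ d0 al0 pc.
  have C0 := bigavg_cst_gt0 d0 dn rd rp ap.
  have k0 := @sum_decay_gt0 R n d alpha r p d0 dn rd rp.
  have TC := fmaximal_controlled d0 dn al0 aln rd rp ap.
  exact: (controlled_weak d0 dn rd rp ap q0 sc C0 k0 TC).
- have [C0 k0 TC] := strict d alpha r p d0 dn al0 aln rd rp pc.
  have ap := crit _ _ _ d0 (ltW al0) pc.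
  exact: (controlled_weak d0 (ltW dn) (ltW rd) rp ap q0 sc C0 k0 TC).
- have [C0 k0 TC] := strict d alpha r p d0 dn al0 aln rd rp pc.
  have ap := crit _ _ _ d0 (ltW al0) pc.
  exact: (controlled_strong d0 (ltW dn) (ltW al0) (ltW rd) rp ap q0 sc C0 k0 TC).
Qed.
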